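(* For squarefree $d>1$, the null crossing $s_*(d)$ is an integer if and only if $d=3$, and $s_*(3)=2$.
   Context: $\chi_d$ is the Kronecker symbol of the fundamental discriminant of $\mathbb{Q}(\sqrt d)$. For squarefree $d>1$, $s_*(d)$ denotes the unique $s\in(1,\infty)$ with $\zeta(s)^2=d\,L(s,\chi_d)^2$ (equivalently $\zeta(s)/L(s,\chi_d)=\sqrt d$). *)

(* Defs.v *)
From HB Require Import structures.
From mathcomp Require Import all_boot all_order all_algebra.
From mathcomp Require Import all_classical all_reals all_analysis.

Set Implicit Arguments.
Unset Strict Implicit.
Unset Printing Implicit Defensive.

Import Order.TTheory GRing.Theory Num.Theory.
Import numFieldNormedType.Exports.

Local Open Scope classical_set_scope.
Local Open Scope ring_scope.

Definition squarefree (n : nat) : Prop :=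
  forall m : nat, (m ^ 2 %| n)%N -> m = 1%N.

(* The discriminant of the ring of integers of Q(sqrt d), for d > 1
   squarefree. *)
Definition fund_disc (d : nat) : nat :=
  if (d %% 4 == 1)%N then d else (4 * d)%N.

(* (a/p) for an odd prime p. *)
Definition legendre_symbol (a : int) (p : nat) : int :=
  if (p %| a)%Z then 0
  else if [exists x : 'I_p, ((x : nat)%:Z ^+ 2 == a %[mod p])%Z] then 1
  else -1.

Definition kronecker_symbol_prime (a : int) (p : nat) : int :=
  if p == 2%N then
    if (2 %| a)%Z then 0
    else if (a == 1 %[mod 8])%Z || (a == -1 %[mod 8])%Z then 1 else -1
  else legendre_symbol a p.

(* The Kronecker symbol (a/n), extended multiplicatively from the primes;
   only lower arguments n >= 0 are covered. *)
Definition kronecker_symbol (a : int) (n : nat) : int :=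
  if n == 0%N then (`|a|%N == 1%N)%:R
  else \prod_(p <- primes n) kronecker_symbol_prime a p ^+ logn p n.

Definition chi (d n : nat) : int := kronecker_symbol (fund_disc d)%:Z n.

Section Dirichlet.
Variable R : realType.

(* \sum_(n >= 1) a n / n ^ s; the index is shifted since sequences start
   at 0. *)
Definition dirichlet_series (a : nat -> R) (s : R) : R :=
  limn (series (fun n : nat => a n.+1 * n.+1%:R `^ (- s))).

Definition zeta (s : R) : R := dirichlet_series (fun=> 1) s.

Definition Lchi (d : nat) (s : R) : R :=
  dirichlet_series (fun n => (chi d n)%:~R) s.

Definition null_crossing_eq (d : nat) (s : R) : Prop :=
  1 < s /\ zeta s ^+ 2 = d%:R * Lchi d s ^+ 2.

(* The unique solution s in (1, +oo).  If there were no solution, or several,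
   the value would be the junk value 0. *)
Definition null_crossing (d : nat) : R :=
  xget 0 [set s | unique (null_crossing_eq d) s].

End Dirichlet.

Arguments null_crossing : clear implicits.

(* Main.v *)
(** Let Q(s) = zeta(s) / L(s, chi_d).  Removing the Euler factors at the primes
    up to N from both series leaves a quotient tending to 1, so Q is the limit
    of the products of (1 - chi(p) p^-s) / (1 - p^-s), each nonincreasing in s
    and strictly decreasing when p divides d.  L(s, chi_d) stays bounded as s
    tends to 1 because chi_d, restricted to the integers prime to 8d, is a
    nontrivial periodic character: with z a primitive 8d-th root of unity,
    sqrt d = P(z) for some P in Z[X], the sign P(z^n) / P(z) is multiplicative
    and periodic in n, and at a prime p it is the Legendre symbol by Frobenius
    and Euler's criterion.  Hence Q decreases continuously from +oo, and
    removing the factor at 2 gives Q(3) < sqrt d: there is exactly one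
    crossing, and it is < 3.  If it is an integer it is 2, and crude bounds on
    Q(2) exclude every d except 3.  Finally Q(2) = sqrt 3 for d = 3 follows
    from the partial fractions of 1 / sin^2 at pi/12 and 5pi/12. *)

Require Import Defs.
From mathcomp Require Import all_boot all_order all_algebra all_field.
From mathcomp Require Import all_classical all_reals all_analysis.
From mathcomp Require Import zify ring lra.

Set Implicit Arguments.
Unset Strict Implicit.
Unset Printing Implicit Defensive.

Import Order.TTheory GRing.Theory Num.Theory.
Import numFieldNormedType.Exports.

Local Open Scope classical_set_scope.
Local Open Scope ring_scope.

(** * Euler's criterion *)

Lemma Fp_int_eq0 (p : nat) (a : int) : prime p ->
  ((a%:~R : 'F_p) == 0) = (p %| a)%Z.
Proof.
move=> pp; have pc := pchar_Fp pp.
case: a => n; first by rewrite -pmulrn -(dvdn_pcharf pc) dvdzE.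
by rewrite NegzE rmorphN /= oppr_eq0 -pmulrn -(dvdn_pcharf pc) dvdzE abszN.
Qed.

Lemma Fp_nat_eq (p a b : nat) : prime p -> (a < p)%N -> (b < p)%N ->
  (a%:R == b%:R :> 'F_p) = (a == b).
Proof.
move=> pp ap bp.
apply/eqP/eqP => [/(congr1 val)|-> //].
by rewrite /= !val_Fp_nat // !modn_small.
Qed.

Lemma fermat_Fp (p : nat) (x : 'F_p) : prime p -> x != 0 -> x ^+ p.-1 = 1.
Proof.
move=> pp x0; apply: (mulfI x0); rewrite -exprS prednK ?prime_gt0 // mulr1.
by have := expf_card x; rewrite card_Fp.
Qed.

Lemma legendre_symbol_sqr (p : nat) (a : int) : prime p -> ~~ (p %| a)%Z ->
  legendre_symbol a p = 1 \/
  (legendre_symbol a p = -1 /\ forall x : 'F_p, x ^+ 2 != a%:~R).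
Proof.
move=> pp pa; rewrite /legendre_symbol (negbTE pa).
case: ifPn => [_|/existsPn nex]; [by left | right; split => // x].
apply/negP => /eqP xa.
have xp : (x < p)%N by rewrite -[X in (_ < X)%N](Fp_cast pp).
have /negP := nex (Ordinal xp); apply => /=.
rewrite eqz_mod_dvd -Fp_int_eq0 // rmorphB rmorphXn /= -xa subr_eq0.
by rewrite -pmulrn natr_Zp.
Qed.

(** For a residue this is Fermat's theorem. For a non-residue the power is 1 or -1, and the value 1
    would give ['X^(p./2) - 1] one root too many. *)
Lemma euler_criterion (p : nat) (a : int) : prime p -> odd p ->
  ~~ (p %| a)%Z ->
  ((legendre_symbol a p)%:~R : 'F_p) = a%:~R ^+ p./2.
Proof.
move=> pp op pa; have a0 : (a%:~R : 'F_p) != 0 by rewrite Fp_int_eq0.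
have pE : p = (p./2 * 2).+1 by rewrite muln2 -[LHS]odd_double_half op.
have pE1 : p.-1 = (2 * p./2)%N by rewrite [LHS](congr1 predn pE) mulnC.
have h0 : (0 < p./2)%N by have := prime_gt1 pp; lia.
have [E|[E nsq]] := legendre_symbol_sqr pp pa; rewrite E.
  move: E; rewrite /legendre_symbol (negbTE pa).
  case: ifP => [/existsP[x /eqP xa] _|//].
  have {xa}xa : (x : nat)%:R ^+ 2 = a%:~R :> 'F_p.
    apply/eqP; rewrite -subr_eq0 pmulrn -rmorphXn -rmorphB Fp_int_eq0 //.
    by rewrite -eqz_mod_dvd; apply/eqP.
  rewrite -xa -exprM -pE1 fermat_Fp //.
  by apply: contra a0 => /eqP x0; rewrite -xa x0 expr0n.
have : (a%:~R ^+ p./2 : 'F_p) ^+ 2 == 1 by rewrite -exprM mulnC -pE1 fermat_Fp.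
rewrite sqrf_eq1 => /orP[] /eqP a1; last by rewrite a1 rmorphN.
(* These [p./2 + 1] elements are distinct: [a] is no square, and two squares agree only if [i = j]
   or [p] divides [i + j], which is smaller than [p]. *)
pose s := a%:~R :: [seq (i%:R : 'F_p) ^+ 2 | i <- iota 1 p./2].
have us : uniq s.
  rewrite /= map_inj_in_uniq ?iota_uniq ?andbT.
    by apply/mapP => -[i _ ai]; have := nsq i%:R; rewrite -ai eqxx.
  move=> i j; rewrite !mem_iota => /andP[i1 i2] /andP[j1 j2].
  move/eqP; rewrite eqf_sqr => /orP[]; first by rewrite Fp_nat_eq //; lia.
  rewrite -subr_eq0 opprK -natrD -(dvdn_pcharf (pchar_Fp pp)) => /dvdn_leq.
  lia.
have P0 : ('X^(p./2) - 1 : {poly 'F_p}) != 0.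
  by rewrite -size_poly_eq0 size_XnsubC.
suff al : all (root ('X^(p./2) - 1)) s.
  by have := max_poly_roots P0 al us; rewrite size_XnsubC //= size_map size_iota ltnn.
apply/allP => x.
rewrite inE => /orP[/eqP ->|/mapP[i]].
  by rewrite /root !hornerE a1 subrr.
rewrite mem_iota => /andP[i1 i2] ->.
rewrite /root !hornerE -exprM -pE1 fermat_Fp ?subrr //.
by rewrite -(dvdn_pcharf (pchar_Fp pp)); apply/negP => /dvdn_leq; lia.
Qed.

(** * Square roots in cyclotomic integers *)

Section EvalInt.

Definition int_horner (P : {poly int}) (x : algC) : algC :=
  (map_poly intr P).[x].

Lemma int_hornerM P Q x :
  int_horner (P * Q) x = int_horner P x * int_horner Q x.
Proof. by rewrite /int_horner rmorphM hornerM. Qed.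

Lemma int_hornerXn n x : int_horner 'X^n x = x ^+ n.
Proof. by rewrite /int_horner map_polyXn hornerXn. Qed.

Lemma int_hornerX x : int_horner 'X x = x.
Proof. by rewrite /int_horner map_polyX hornerX. Qed.

Lemma int_hornerC c x : int_horner c%:P x = c%:~R.
Proof. by rewrite /int_horner map_polyC hornerC. Qed.

Lemma int_hornerD P Q x :
  int_horner (P + Q) x = int_horner P x + int_horner Q x.
Proof. by rewrite /int_horner rmorphD hornerD. Qed.

Lemma int_horner_aut (u : {rmorphism algC -> algC}) P x :
  u (int_horner P x) = int_horner P (u x).
Proof.
rewrite /int_horner -horner_map -map_poly_comp; congr (_.[_]).
by apply: eq_map_poly => c /=; rewrite rmorph_int.
Qed.

Lemma int_horner_Aint P x : x \in Aint -> int_horner P x \in Aint.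
Proof.
move=> xA; rewrite /int_horner horner_coef rpred_sum // => i _.
by rewrite rpredM ?rpredX // coef_map Aint_int.
Qed.

Lemma Aint_FrobeniusD (p : nat) x y : prime p -> x \in Aint -> y \in Aint ->
  ((x + y) ^+ p == x ^+ p + y ^+ p %[mod p])%A.
Proof.
move=> pp xA yA; have := prime_gt0 pp; case: p pp => // p pp _.
rewrite exprDn big_ord_recl big_ord_recr /= subn0 bin0 mulr1n expr0 mulr1.
rewrite /bump /= add1n subnn binn mulr1n expr0 mul1r.
rewrite /eqAmod [X in (_ %| X)%A](_ : _ = \sum_(i < p)
   (x ^+ (p.+1 - bump 0 i) * y ^+ bump 0 i *+ 'C(p.+1, bump 0 i))); last by ring.
rewrite rpred_sum // => i _; rewrite -eqAmod0 -mulr_natr.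
have /dvdnP[k ->] : (p.+1 %| 'C(p.+1, bump 0 i))%N.
  by apply: prime_dvd_bin => //; rewrite /bump /= add1n /=; have := ltn_ord i; lia.
by rewrite natrM mulrA eqAmodMl0 // !rpredM ?rpredX // rpred_nat.
Qed.

(** Induction on [P]: the [p]-th power is additive modulo [p] on algebraic integers, and it fixes
    the integer coefficients modulo [p] by Fermat. *)
Lemma int_horner_Frobenius (p : nat) P x : prime p -> x \in Aint ->
  (int_horner P (x ^+ p) == int_horner P x ^+ p %[mod p])%A.
Proof.
move=> pp xA; elim/poly_ind: P => [|P c IH].
  by rewrite /int_horner rmorph0 !horner0 expr0n gtn_eqF ?prime_gt0 // eqAmod_refl.
rewrite !int_hornerD !int_hornerM !int_hornerX !int_hornerC.
rewrite eqAmod_sym; apply: eqAmod_trans (Aint_FrobeniusD _ _ _) _ => //.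
- by rewrite rpredM // int_horner_Aint.
- exact: Aint_int.
apply: eqAmodD; first by rewrite exprMn eqAmodMr ?rpredX // eqAmod_sym.
have [k kE] : exists k : int, c ^+ p - c = k * p.
  have : (p %| c ^+ p - c)%Z.
    rewrite -Fp_int_eq0 // rmorphB rmorphXn /= subr_eq0; apply/eqP.
    by have := expf_card (c%:~R : 'F_p); rewrite card_Fp.
  by move/dvdzP.
rewrite /eqAmod -rmorphXn -rmorphB kE rmorphM /= -pmulrn -eqAmod0.
exact/eqAmodMl0/Aint_int.
Qed.

End EvalInt.

Section SquareRoots.

(** Cancel [X - 1] in the factorization of [X^q - 1] and evaluate at 1. *)
Lemma prod_1sub_prim_root (q : nat) (y : algC) : (0 < q)%N ->
  q.-primitive_root y -> \prod_(1 <= k < q) (1 - y ^+ k) = q%:R.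
Proof.
move=> q0 py.
have : ('X - 1%:P) * \prod_(1 <= k < q) ('X - (y ^+ k)%:P) =
       ('X - 1%:P) * \sum_(i < q) 'X^i :> {poly algC}.
  rewrite -[1%:P in RHS]/(1 : {poly algC}) -subrX1 -(factor_Xn_sub_1 py).
  by rewrite [RHS]big_ltn.
move/(mulfI (negbT (polyXsubC_eq0 _)))/(congr1 (fun P => P.[1])).
rewrite horner_prod horner_sum.
under eq_bigr do rewrite !hornerE.
move=> ->; under eq_bigr do rewrite hornerXn expr1n.
by rewrite sumr_const card_ord.
Qed.

(* Pairing k with q - k in q = \prod_(0 < k < q) (1 - y^k) and using
   1 - y^(q-k) = - y^(q-k) (1 - y^k) exhibits (-1)^((q-1)/2) q as a square. *)
Lemma sqrt_prime_cyclotomic (q : nat) (y : algC) : prime q -> odd q ->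
  q.-primitive_root y ->
  exists P : {poly int}, int_horner P y ^+ 2 = (-1) ^+ q./2 * q%:R.
Proof.
move=> qp oq py; set e := q./2.
have qE : q = (e + e).+1 by rewrite addnn -[LHS]odd_double_half oq.
have yq : y ^+ q = 1 by apply: prim_expr_order.
pose A : {poly int} := \prod_(1 <= k < e.+1) (1 - 'X^k).
pose S := (\sum_(1 <= k < e.+1) (q - k))%N.
(* Since [2 * e.+1 = q + 1], multiplying the exponent [S] by [e.+1] halves it modulo [q], so that
   the first factor is a square root of [y ^+ S]. *)
exists ('X^(S * e.+1) * A).
have yS : y ^+ (S * e.+1) ^+ 2 = y ^+ S.
  rewrite -exprM -mulnA (_ : (e.+1 * 2 = q + 1)%N); last by rewrite qE; lia.
  by rewrite mulnDr muln1 exprD mulnC exprM yq expr1n mul1r.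
have AE : int_horner A y = \prod_(1 <= k < e.+1) (1 - y ^+ k).
  rewrite /int_horner rmorph_prod horner_prod; apply: eq_bigr => k _.
  by rewrite rmorphB rmorph1 /= map_polyXn !hornerE.
rewrite int_hornerM int_hornerXn exprMn yS AE -(prod_1sub_prim_root _ py) ?prime_gt0 //.
have le : (e.+1 <= q)%N by rewrite qE ltnS leq_addr.
rewrite [X in _ = _ * X](@big_cat_nat _ _ _ e.+1) //=.
have -> : \prod_(e.+1 <= k < q) (1 - y ^+ k) =
          \prod_(1 <= k < e.+1) (1 - y ^+ (q - k)).
  rewrite big_nat_rev /= -{1}add1n big_addn.
  rewrite (_ : (q - e = e.+1)%N); last by lia.
  by apply: eq_big_nat => i /andP[i1 i2]; congr (1 - y ^+ _); lia.
rewrite -big_split /= [y ^+ S](_ : _ = \prod_(1 <= k < e.+1) y ^+ (q - k)); last first.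
  by rewrite /S; elim/big_rec2: _ => [|i a b _ <-]; rewrite ?expr0 // exprD.
have -> : (-1) ^+ e = \prod_(1 <= k < e.+1) (-1) :> algC.
  by rewrite prodr_const_nat subn1.
rewrite -prodrXl -!big_split /=; apply: eq_big_nat => k /andP[k1 k2].
have : y ^+ (q - k) * y ^+ k = 1 by rewrite -exprD subnK //; lia.
move: (y ^+ (q - k)) (y ^+ k) => a b ab.
have -> : (1 - b) * (1 - a) = 1 - a - b + a * b by ring.
have -> : a * (1 - b) ^+ 2 = a - (a * b) *+ 2 + a * b * b by ring.
by rewrite ab; ring.
Qed.

(** Strong induction on [d], splitting off its smallest prime factor [q]. The factor 8 in the
    modulus supplies the eighth root of unity for the square root of 2 and the fourth root that
    corrects the sign for odd [q]. *)
Lemma sqrt_nat_cyclotomic (d M : nat) (z : algC) : (0 < d)%N ->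
  (8 * d %| M)%N -> M.-primitive_root z ->
  exists P : {poly int}, int_horner P z ^+ 2 = d%:R.
Proof.
have [n] := ubnP d; elim: n d M z => // n IH d M z dn d0 dM pz.
have M0 := prim_order_gt0 pz.
have [d1|d1] := leqP d 1.
  by exists 1; rewrite [d](_ : _ = 1%N) ?/int_horner ?rmorph1 ?hornerC ?expr1n //; lia.
pose q := pdiv d; have qp : prime q := pdiv_prime d1.
have /dvdnP[m dE] := pdiv_dvd d; rewrite -/q in dE.
have q1 := prime_gt1 qp.
have m0 : (0 < m)%N by lia.
have [P HP] : exists P : {poly int}, int_horner P z ^+ 2 = m%:R.
  apply: (IH m M) => //; first by nia.
  by apply: dvdn_trans dM; rewrite dE mulnA dvdn_mulr.
suff [Q HQ] : exists P : {poly int}, int_horner P z ^+ 2 = q%:R.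
  by exists (P * Q); rewrite int_hornerM exprMn HP HQ dE natrM.
have qM : (8 * q %| M)%N by apply: dvdn_trans dM; rewrite dE mulnCA dvdn_mull.
have exXn (P' : {poly int}) k : int_horner P' (z ^+ k) = int_horner (P' \Po 'X^k) z.
  rewrite /int_horner map_comp_poly /= map_polyXn horner_comp hornerXn //.
have [q2|oq] := even_prime qp.
  have d8 : (8 %| M)%N by apply: dvdn_trans qM; rewrite dvdn_mulr.
  pose t := z ^+ (M %/ 8).
  have pt : 8.-primitive_root t := dvdn_prim_root pz d8.
  have t4 : t ^+ 4 = -1.
    have : t ^+ 4 ^+ 2 == 1 by rewrite -exprM (prim_expr_order pt).
    rewrite sqrf_eq1 => /orP[]/eqP // /eqP.
    by rewrite -(prim_order_dvd pt).
  (* This is [t + t^-1] for a primitive eighth root of unity [t], whose square is 2. *)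
  exists ('X^(M %/ 8) + 'X^(M %/ 8 * 7)).
  rewrite int_hornerD !int_hornerXn exprM -/t q2.
  have -> : (t + t ^+ 7) ^+ 2 = t ^+ 2 + (t ^+ 4) ^+ 2 *+ 2 + t ^+ 2 * (t ^+ 4) ^+ 3 by ring.
  by rewrite t4; ring.
have d4 : (4 %| M)%N by apply: dvdn_trans qM; rewrite (dvdn_mulr _ (isT : 4 %| 8)%N).
pose t := z ^+ (M %/ 4).
have pt : 4.-primitive_root t := dvdn_prim_root pz d4.
have t2 : t ^+ 2 = -1.
  have : t ^+ 2 ^+ 2 == 1 by rewrite -exprM (prim_expr_order pt).
  rewrite sqrf_eq1 => /orP[]/eqP // /eqP.
  by rewrite -(prim_order_dvd pt).
have dq : (q %| M)%N by apply: dvdn_trans qM; rewrite dvdn_mull.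
have [Q HQ] := sqrt_prime_cyclotomic qp oq (dvdn_prim_root pz dq).
(* The square of [t ^+ q./2] is [(-1) ^+ q./2], which cancels the sign in the square of [Q]. *)
exists ('X^(M %/ 4 * q./2) * (Q \Po 'X^(M %/ q))).
rewrite int_hornerM exprMn -exXn HQ int_hornerXn exprM -/t.
by rewrite -exprM mulnC exprM t2 mulrA -exprMn mulrNN mulr1 expr1n mul1r.
Qed.

End SquareRoots.

(** * Periodicity of the Kronecker symbol *)

Section KroneckerSymbol.

(** An index range independent of [n] lets the products for [m], [n] and [m * n] be compared factor
    by factor. *)
Lemma kronecker_prod (a : int) (n N : nat) : (0 < n)%N -> (n < N)%N ->
  kronecker_symbol a n =
  \prod_(p <- iota 0 N | prime p) kronecker_symbol_prime a p ^+ logn p n.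
Proof.
move=> n0 nN; rewrite /kronecker_symbol gtn_eqF //.
rewrite -[RHS]big_filter /=.
have sub : perm_eq (primes n) [seq p <- [seq p <- iota 0 N | prime p] | p \in primes n].
  apply: uniq_perm; rewrite ?primes_uniq ?filter_uniq ?iota_uniq // => p.
  rewrite !mem_filter mem_iota /=; case: (boolP (p \in primes n)) => //=.
  by rewrite mem_primes => /and3P[-> _ /(dvdn_leq n0)] /=; lia.
rewrite (perm_big _ sub) big_filter [RHS](bigID (fun p => p \in primes n)) /=.
rewrite [X in _ = _ * X]big1_seq ?mulr1 // => p /andP[pn].
rewrite mem_filter => /andP[pp _].
by move: pn; rewrite -logn_gt0 -eqn0Ngt => /eqP ->.
Qed.

Lemma kronecker_symbolM (a : int) (m n : nat) : (0 < m)%N -> (0 < n)%N ->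
  kronecker_symbol a (m * n) = kronecker_symbol a m * kronecker_symbol a n.
Proof.
move=> m0 n0; rewrite !(@kronecker_prod _ _ (m * n).+1) ?muln_gt0 ?m0 //;
  try by nia.
by rewrite -big_split; apply: eq_bigr => p _; rewrite /= lognM // exprD.
Qed.

Lemma kronecker_symbol_primeE (a : int) (p : nat) : prime p ->
  kronecker_symbol a p = kronecker_symbol_prime a p.
Proof.
move=> pp; rewrite /kronecker_symbol gtn_eqF ?prime_gt0 // primes_prime //.
by rewrite big_seq1 logn_prime // eqxx.
Qed.

Lemma kronecker_symbol1 (a : int) : kronecker_symbol a 1 = 1.
Proof. by rewrite /kronecker_symbol big_nil. Qed.

Lemma legendre_cases (a : int) (p : nat) :
  legendre_symbol a p \in [:: -1; 0; 1 : int].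
Proof. by rewrite /legendre_symbol; case: ifP => // _; case: ifP. Qed.

Lemma kronecker_prime_cases (a : int) (p : nat) :
  kronecker_symbol_prime a p \in [:: -1; 0; 1 : int].
Proof.
rewrite /kronecker_symbol_prime; case: ifP => _; last exact: legendre_cases.
by case: ifP => // _; case: ifP.
Qed.

Lemma kronecker_cases (a : int) (n : nat) : (0 < n)%N ->
  kronecker_symbol a n \in [:: -1; 0; 1 : int].
Proof.
move=> n0; rewrite /kronecker_symbol gtn_eqF //.
elim/big_ind: _ => // [x y|p _].
  by rewrite !inE => /or3P[]/eqP-> /or3P[]/eqP->.
elim: (logn p n) => // k IH; rewrite exprS.
move: (kronecker_prime_cases a p) IH.
by rewrite !inE => /or3P[]/eqP-> /or3P[]/eqP->.
Qed.

End KroneckerSymbol.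

(** * The quadratic character as the Galois action on a square root of [d] *)

Section CyclotomicCharacter.

Variables (d : nat).
Hypotheses (d1 : (1 < d)%N) (dsq : squarefree d).
Let M := (8 * d)%N.

(** Multiplication by the principal character modulo [m]; in the Dirichlet series of a completely
    multiplicative [f] it deletes the Euler factors at the primes dividing [m]. *)
Definition restrict_coprime (T : nzRingType) (m : nat) (f : nat -> T) (n : nat) : T :=
  if coprime m n then f n else 0.

(** The discriminant is [d] or [4 * d], and 4 is a square. Euler's criterion compares the two
    symbols in ['F_p], where 1 and -1 stay distinct because [p] is odd. *)
Lemma legendre_chi (p : nat) : prime p -> odd p -> ~~ (p %| d)%N ->
  chi d p = legendre_symbol d p.
Proof.
move=> pp op pd; rewrite /chi kronecker_symbol_primeE //.
rewrite /kronecker_symbol_prime; case: eqP => [p2|_]; first by rewrite p2 in op.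
rewrite /fund_disc; case: ifP => // _.
have p2 : ~~ (p %| 2)%N by rewrite dvdn_prime2 //; apply: contraL op => /eqP->.
have p4 : ~~ (p %| 4)%N by rewrite -[4%N]/(2 ^ 2)%N Euclid_dvdX // andbT.
have zd (k : nat) : ~~ (p %| k)%N -> ~~ (p %| k%:Z)%Z by rewrite dvdzE.
have ne : (1 : 'F_p) != -1.
  by rewrite -subr_eq0 opprK -[_ + _]/(2%:R) -(dvdn_pcharf (pchar_Fp pp)).
have inj (x y : int) : x \in [:: -1; 1] -> y \in [:: -1; 1] ->
    (x%:~R : 'F_p) = y%:~R -> x = y.
  rewrite !inE => /orP[]/eqP-> /orP[]/eqP-> //.
    by rewrite rmorphN => /eqP; rewrite eq_sym (negbTE ne).
  by rewrite rmorphN => /eqP; rewrite (negbTE ne).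
have leg (k : nat) : ~~ (p %| k)%N -> legendre_symbol k p \in [:: -1; 1].
  by move=> /zd /(legendre_symbol_sqr pp)[->|[->]].
have p4d : ~~ (p %| 4 * d)%N by rewrite Euclid_dvdM // negb_or p4.
apply: inj; [exact: leg|exact: leg|].
rewrite (euler_criterion pp op (zd _ p4d)) (euler_criterion pp op (zd _ pd)).
rewrite PoszM rmorphM /= exprMn -pmulrn (natrX _ 2 2) -exprM mul2n halfK op subn1 fermat_Fp ?mul1r //.
by rewrite -(dvdn_pcharf (pchar_Fp pp)).
Qed.

(** With [z] a primitive [M]-th root of unity and [P(z)] a square root of [d], take [E n = P(z^n)].
    For [n] prime to [M] this is the image of the square root under the automorphism sending [z] to
    [z^n], so its sign is a periodic character. *)
Lemma chi_cyclotomic : exists E : nat -> algC,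
  [/\ E 1%N ^+ 2 = d%:R,
      forall n, E (n + M)%N = E n,
      exists2 k, coprime M k & E k != E 1%N &
      forall n, coprime M n -> E n = (chi d n)%:~R * E 1%N].
Proof.
have d0 : (0 < d)%N := ltnW d1.
have M0 : (0 < M)%N by rewrite muln_gt0.
have [z pz] := C_prim_root_exists M0.
have [P HP] := sqrt_nat_cyclotomic d0 (dvdnn _) pz.
exists (fun n => int_horner P (z ^+ n)); rewrite expr1.
set w := int_horner P z in HP *.
have wn0 : w != 0 by rewrite -sqrf_eq0 HP pnatr_eq0 -lt0n.
have Eaut n : coprime M n -> exists2 u : {rmorphism algC -> algC},
    u z = z ^+ n & u w = int_horner P (z ^+ n).
  rewrite coprime_sym => /Qn_aut_exists[u Hu].
  by exists u; rewrite ?int_horner_aut Hu ?(prim_expr_order pz).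
have Esq n : coprime M n ->
    int_horner P (z ^+ n) = w \/ int_horner P (z ^+ n) = - w.
  move=> /Eaut[u _ <-]; have : (u w) ^+ 2 == w ^+ 2.
    by rewrite -rmorphXn HP rmorph_nat.
  by rewrite eqf_sqr => /orP[]/eqP; [left|right].
split => //.
- by move=> n; rewrite exprD (prim_expr_order pz) mulr1.
(* If the sign were always 1, [P - w] would vanish at every primitive [M]-th root of unity. Then [w]
   is rational, and being an algebraic integer it is an integer, so [d] is a perfect square, against
   squarefreeness. *)
- apply: contrapT => nex.
  have Ew n : coprime M n -> int_horner P (z ^+ n) = w.
    by move=> cn; apply: contrapT => ne; apply: nex; exists n => //; apply/eqP.
  pose PC := map_poly intr P : {poly algC}.
  have dv : cyclotomic z M %| PC - w%:P.
    rewrite /cyclotomic -big_filter.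
    rewrite -(big_map (fun k : 'I_M => z ^+ k) xpredT (fun x => 'X - x%:P)).
    apply: uniq_roots_dvdp.
      apply/allP => x /mapP[k]; rewrite mem_filter => /andP[ck _] ->.
      by rewrite /root !hornerE -/(int_horner _ _) Ew ?subrr // coprime_sym.
    rewrite uniq_rootsE map_inj_in_uniq ?filter_uniq ?index_enum_uniq //.
    move=> i j _ _ /eqP; rewrite (eq_prim_root_expr pz) !modn_small //.
    by move=> /eqP /val_inj.
  have wr : w \in Crat.
    (* The constant [w] is the remainder of [P] modulo the cyclotomic polynomial; both polynomials
       have rational coefficients, hence so does the remainder. *)
    have : w%:P = map_poly ratr ((map_poly intr P : {poly rat}) %% map_poly intr 'Phi_M).
      rewrite map_modp -!map_poly_comp !(@eq_map_poly _ _ (ratr \o intr) intr); last first.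
      - by move=> c /=; rewrite ratr_int.
      - by move=> c /=; rewrite ratr_int.
      rewrite (Cintr_Cyclotomic pz) -/PC -[PC](subrK w%:P) modpD.
      rewrite (modp_eq0 dv) add0r modp_small //.
      rewrite size_cyclotomic size_polyC wn0 ltnS totient_gt0 //.
    move=> /(congr1 (fun Q : {poly algC} => Q`_0)); rewrite coefC coef_map /= => ->.
    exact: Crat_rat.
  have /intrP[k wk] : w \in Num.int.
    by apply: Cint_rat_Aint => //; apply/int_horner_Aint/(Aint_prim_root pz).
  have dk : (d = `|k| ^ 2)%N.
    have : (k ^+ 2)%:~R = d%:~R :> algC by rewrite rmorphXn /= -wk HP.
    by move=> /eqP; rewrite eqr_int -abszX => /eqP ->.
  have k1 : `|k|%N = 1%N by apply: dsq; rewrite -dk.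
  by move: d1; rewrite dk k1.
move=> n; have [N] := ubnP n; elim: N n => // N IH n nN cn.
have n0 : (0 < n)%N by rewrite lt0n; apply: contraL cn => /eqP ->; rewrite /coprime gcdn0; lia.
have [n1|n1] := leqP n 1.
  have -> : n = 1%N by lia.
  by rewrite /chi kronecker_symbol1 mul1r expr1.
pose p := pdiv n; have pp : prime p := pdiv_prime n1.
have /dvdnP[m nE] := pdiv_dvd n; rewrite -/p in nE.
have cp : coprime M p by move: cn; rewrite nE coprimeMr => /andP[].
have cm : coprime M m by move: cn; rewrite nE coprimeMr => /andP[].
have p1 := prime_gt1 pp.
have Hm := IH m _ cm.
have Hp : int_horner P (z ^+ p) = (chi d p)%:~R * w.
  have [op pd] : odd p /\ ~~ (p %| d)%N.
    move: cp; rewrite /M coprimeMl => /andP[c8 cd]; split.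
      by move: c8; rewrite -[8%N]/(2 ^ 3)%N coprime_pexpl // prime_coprime // dvdn2 negbK.
    by rewrite -prime_coprime // coprime_sym.
  have pdz : ~~ (p %| d%:Z)%Z by rewrite dvdzE.
  have zA := Aint_prim_root pz.
  have wA : w \in Aint by apply: int_horner_Aint.
  have H1 := int_horner_Frobenius P pp zA; rewrite -/w in H1.
  (* [w ^+ p] is [w] times [d ^+ p./2], to which Euler's criterion applies. *)
  have H2 : (w ^+ p == (legendre_symbol d p)%:~R * w %[mod p])%A.
    rewrite -[X in w ^+ X]odd_double_half op exprS -mul2n exprM HP mulrC.
    apply: eqAmodMr => //; rewrite /eqAmod.
    have /dvdzP[k kE] : (p %| d%:Z ^+ p./2 - legendre_symbol d p)%Z.
      by rewrite -Fp_int_eq0 // rmorphB rmorphXn /= euler_criterion // subrr.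
    have -> : d%:R ^+ p./2 - (legendre_symbol d p)%:~R = k%:~R * p%:R :> algC.
      by rewrite [p%:R]pmulrn -rmorphM -kE rmorphB rmorphXn /= -pmulrn.
    by rewrite -eqAmod0; apply/eqAmodMl0/Aint_int.
  have H3 := eqAmod_trans H1 H2.
  (* Multiplied by [w], the congruence would make [p] divide [2 * d]. Hence the residue modulo [p]
     determines the sign. *)
  have bad : ~ (w == - w %[mod p])%A.
    move=> /(eqAmodMr wA); rewrite mulNr -expr2 HP /eqAmod opprK -natrD.
    rewrite -eqAmod0 eqAmod0_nat addnn -mul2n Euclid_dvdM // (negbTE pd) orbF.
    by rewrite dvdn_prime2 // => /eqP p2; rewrite p2 in op.
  rewrite legendre_chi //.
  move: H3; have [->|[-> _]] := legendre_symbol_sqr pp pdz.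
    by rewrite !mul1r => H3; have [//|Ep] := Esq _ cp; rewrite Ep eqAmod_sym in H3.
  by rewrite !mulN1r => H3; have [Ep|//] := Esq _ cp; rewrite Ep in H3.
have m0 : (0 < m)%N by lia.
rewrite nE /chi kronecker_symbolM ?(ltnW p1) // rmorphM /=.
(* Applying the automorphism [u], which sends [z] to [z ^+ p], to the identity for [m] yields the
   identity for [m * p]. *)
have [u uz uw] := Eaut _ cp.
rewrite mulnC exprM -uz -rmorphXn -int_horner_aut Hm; last by nia.
by rewrite rmorphM /= rmorph_int uw Hp mulrA.
Qed.

Lemma chi_periodic (n : nat) :
  restrict_coprime M (chi d) (n + M) = restrict_coprime M (chi d) n.
Proof.
have [E [E1 Eper _ Echi]] := chi_cyclotomic.
have En0 : E 1%N != 0 by rewrite -sqrf_eq0 E1 pnatr_eq0 -lt0n ltnW.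
have cE : coprime M (n + M) = coprime M n.
  by rewrite /coprime -[X in gcdn M (_ + X)]mul1n addnC gcdnMDl.
rewrite /restrict_coprime cE; case: ifPn => // cn.
have /eqP : (chi d (n + M))%:~R * E 1%N = (chi d n)%:~R * E 1%N.
  by rewrite -!Echi ?cE // Eper.
by rewrite -subr_eq0 -mulrBl mulf_eq0 (negbTE En0) orbF subr_eq0 eqr_int => /eqP.
Qed.

(** Multiplication by a unit [k] with [chi d k != 1] permutes the residues, so the sum equals
    [chi d k] times itself. *)
Lemma chi_sum_period : \sum_(n < M) restrict_coprime M (chi d) n = 0.
Proof.
have [E [E1 _ [k ck Ek] Echi]] := chi_cyclotomic.
have M0 : (0 < M)%N by rewrite /M; lia.
have k0 : (0 < k)%N by rewrite lt0n; apply: contraL ck => /eqP ->; rewrite /coprime gcdn0; lia.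
set F := restrict_coprime M (chi d).
have chik : chi d k != 1.
  by apply: contra Ek => /eqP ck1; rewrite Echi // ck1 mul1r.
have Fmod n : F (n %% M)%N = F n.
  rewrite [in RHS](divn_eq n M) addnC; elim: (n %/ M)%N => [|i IH]; first by rewrite addn0.
  by rewrite mulSn addnCA [(M + _)%N]addnC /F chi_periodic.
have Fk n : F (k * n)%N = chi d k * F n.
  rewrite /F /restrict_coprime coprimeMr ck /=; case: ifPn => cn; last by rewrite mulr0.
  rewrite /chi kronecker_symbolM //.
  by rewrite lt0n; apply: contraL cn => /eqP ->; rewrite /coprime gcdn0; lia.
pose h (n : 'I_M) : 'I_M := Ordinal (ltn_pmod (k * n) M0).
have hinj : injective h.
  have le (x y : 'I_M) : (x <= y)%N -> (k * y == k * x %[mod M])%N -> x = y.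
    move=> xy; rewrite eqn_mod_dvd ?leq_mul2l ?xy ?orbT // -mulnBr Gauss_dvdr //.
    move=> dv; apply: val_inj => /=; have := ltn_ord y.
    by case: (posnP (y - x)) dv => [|p0 /(dvdn_leq p0)]; lia.
  move=> x y /(congr1 val) /= /eqP.
  case/orP: (leq_total x y) => xy; first by rewrite eq_sym; apply: le.
  by move=> /(le _ _ xy).
have : \sum_(n < M) F n = chi d k * \sum_(n < M) F n.
  rewrite [LHS](reindex_inj hinj) /= big_distrr; apply: eq_bigr => n _.
  by rewrite /= Fmod Fk.
move/eqP; rewrite -subr_eq0 -{1}[\sum_(n < M) F n]mul1r -mulrBl mulf_eq0.
by rewrite subr_eq0 eq_sym (negbTE chik) => /eqP.
Qed.

End CyclotomicCharacter.

(** * Dirichlet series and Euler products *)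

Section DirichletSeries.
Variable R : realType.
Implicit Types (a f g : nat -> R) (s t c : R).

Definition dirichlet_partial a s (N : nat) : R :=
  \sum_(1 <= n < N.+1) a n * n%:R `^ (- s).

Definition bounded_by1 a := forall n, (0 < n)%N -> `|a n| <= 1.

Lemma series_dirichlet_partial a s :
  series (fun n : nat => a n.+1 * n.+1%:R `^ (- s)) = dirichlet_partial a s.
Proof.
apply/funext => N; rewrite /series /dirichlet_partial /=.
by rewrite [RHS]big_add1.
Qed.

Lemma powR_tangent (x y t : R) : 0 < x -> 0 < y -> 0 < t ->
  x `^ (- t) - t * x `^ (- (1 + t)) * (y - x) <= y `^ (- t).
Proof.
move=> x0 y0 t0.
rewrite opprD powRD ?(gt_eqF x0) ?implybT // powR_inv1 ?(ltW x0) //.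
rewrite [y `^ _]/powR [x `^ _]/powR (gt_eqF x0) (gt_eqF y0).
have yx : 0 < y / x by rewrite divr_gt0.
have -> : ln y = ln x + ln (y / x) by rewrite -lnM ?posrE // mulrCA divff ?mulr1 ?gt_eqF.
rewrite [- t * (ln x + _)]mulrDr expRD.
have -> : expR (- t * ln x) - t * (x^-1 * expR (- t * ln x)) * (y - x) =
   expR (- t * ln x) * (1 - t * (y / x - 1)) by field; rewrite gt_eqF.
rewrite ler_wpM2l ?expR_ge0 //; apply: le_trans (expR_ge1Dx _).
rewrite mulNr lerD2l lerN2 ler_pM2l //.
have := @le_ln1Dx R (y / x - 1).
by rewrite addrCA subrr addr0; apply; lra.
Qed.

Lemma sum_powR_le t (m N : nat) : 0 < t -> (0 < m)%N -> (m <= N)%N ->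
  t * \sum_(m.+1 <= n < N.+1) n%:R `^ (- (1 + t)) <= m%:R `^ (- t) - N%:R `^ (- t).
Proof.
move=> t0 m0; elim: N => [|N IH]; first by lia.
rewrite leq_eqVlt => /orP[/eqP <-|]; first by rewrite big_geq // mulr0 subrr.
rewrite ltnS => mN; rewrite big_nat_recr //= mulrDr.
have N0 : (0 < N)%N by lia.
have := @powR_tangent N.+1%:R N%:R t; rewrite !ltr0n N0 => /(_ isT isT t0).
rewrite (_ : N%:R - N.+1%:R = -1); last by rewrite -natr1; ring.
have := IH mN; lra.
Qed.

Lemma sum_powR_ge t (N : nat) : 0 < t ->
  1 - N.+1%:R `^ (- t) <= t * \sum_(1 <= n < N.+1) n%:R `^ (- (1 + t)).
Proof.
move=> t0; elim: N => [|N IH].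
  by rewrite big_geq // mulr0 powR1 subrr.
rewrite big_nat_recr //= mulrDr.
have := @powR_tangent N.+1%:R N.+2%:R t; rewrite !ltr0n => /(_ isT isT t0).
rewrite (_ : N.+2%:R - N.+1%:R = 1); last by rewrite -natr1; ring.
have := IH; lra.
Qed.

Lemma nat_powR_cvg0 t : 0 < t -> (n%:R `^ (- t) : R) @[n --> \oo] --> (0 : R).
Proof.
move=> t0; apply/cvgrPdist_le => e e0.
near=> n.
have n0 : 0 < n%:R :> R by rewrite ltr0n; near: n; exists 1%N.
rewrite sub0r normrN ger0_norm ?powR_ge0 //.
rewrite powRN -[e]invrK lef_pV2 ?posrE ?invr_gt0 ?powR_gt0 //.
have e1 : e^-1 = (e^-1 `^ t^-1) `^ t.
  by rewrite -powRrM mulVf ?gt_eqF // powRr1 // invr_ge0 ltW.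
rewrite e1; apply: ge0_ler_powR; rewrite ?nnegrE ?powR_ge0 ?ltW //.
by near: n; apply: nbhs_infty_gtr.
Unshelve. all: by end_near. Qed.

Lemma powR_nat_le (n : nat) s t : (0 < n)%N -> s <= t ->
  n%:R `^ (- t) <= n%:R `^ (- s) :> R.
Proof. by move=> n0 st; rewrite ler_powR ?ler1n // lerN2. Qed.

(** The bound is uniform in [s >= 1 + t], in [N] and in [a]; convergence and continuity in [s] both
    rest on it. *)
Lemma dirichlet_partial_tail a t s (m N : nat) : bounded_by1 a -> 0 < t -> 1 + t <= s ->
  (0 < m)%N -> (m <= N)%N ->
  `|dirichlet_partial a s N - dirichlet_partial a s m| <= m%:R `^ (- t) / t.
Proof.
move=> ab t0 ts m0 mN.
rewrite /dirichlet_partial (@big_cat_nat _ _ _ m.+1) //= addrAC subrr add0r.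
apply: (le_trans (ler_norm_sum _ _ _)).
rewrite ler_pdivlMr // mulrC.
apply: (@le_trans _ _ (t * \sum_(m.+1 <= n < N.+1) n%:R `^ (- (1 + t)))); last first.
  apply: (le_trans (sum_powR_le t0 m0 mN)).
  by rewrite gerBl powR_ge0.
rewrite ler_pM2l //; apply: ler_sum_nat => i /andP[i1 i2].
have i0 : (0 < i)%N by lia.
rewrite normrM (ger0_norm (powR_ge0 _ _)).
apply: (@le_trans _ _ (1 * i%:R `^ (- s))).
  by rewrite ler_wpM2r ?powR_ge0 ?ab.
by rewrite mul1r powR_nat_le.
Qed.

Lemma dirichlet_cvg a s : bounded_by1 a -> 1 < s ->
  dirichlet_partial a s @ \oo --> dirichlet_series a s.
Proof.
move=> ab s1; rewrite /dirichlet_series -series_dirichlet_partial.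
apply: normed_cvg.
rewrite (_ : [normed series _] =
   dirichlet_partial (fun n => `|a n|) s); last first.
  rewrite -series_dirichlet_partial; apply/funext => N.
  by apply: eq_bigr => n _; rewrite /= normrM (ger0_norm (powR_ge0 _ _)).
apply: nondecreasing_is_cvgn.
  apply/nondecreasing_seqP => n; rewrite /dirichlet_partial [X in _ <= X]big_nat_recr //=.
  by rewrite lerDl mulr_ge0 ?powR_ge0.
exists (dirichlet_partial (fun n => `|a n|) s 1 + 1%:R `^ (- (s - 1)) / (s - 1)).
move=> _ [N _ <-].
have bb : bounded_by1 (fun n => `|a n|) by move=> n n0; rewrite normr_id ab.
have [N0|N0] := leqP N 0.
  rewrite (_ : N = 0%N) /dirichlet_partial; last by lia.
  by rewrite big_geq // big_nat1 addr_ge0 ?mulr_ge0 ?invr_ge0 ?powR_ge0 ?subr_ge0 ?(ltW s1).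
have := @dirichlet_partial_tail _ (s - 1) s 1 N bb.
rewrite subr_gt0 => /(_ s1); rewrite addrC subrK => /(_ (lexx _) isT N0).
by move=> /(le_trans (ler_norm _)); lra.
Qed.

Lemma dirichlet_tail a t s (m : nat) : bounded_by1 a -> 0 < t -> 1 + t <= s ->
  (0 < m)%N ->
  `|dirichlet_series a s - dirichlet_partial a s m| <= m%:R `^ (- t) / t.
Proof.
move=> ab t0 ts m0.
have s1 : 1 < s by lra.
have cv : `|dirichlet_partial a s N - dirichlet_partial a s m| @[N --> \oo] -->
    `|dirichlet_series a s - dirichlet_partial a s m|.
  by apply: cvg_norm; apply: cvgB; [exact: dirichlet_cvg|exact: cvg_cst].
apply: cvgr_to_le cv _.
near=> N; apply: dirichlet_partial_tail => //; near: N; exact: nbhs_infty_ge.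
Unshelve. all: by end_near. Qed.

(** The quantitative form of the divergence of zeta at 1, from the telescoped lower bound on its
    partial sums. *)
Lemma zeta_ge t : 0 < t -> t^-1 <= zeta (1 + t).
Proof.
move=> t0; rewrite -[X in X <= _]mul1r ler_pdivrMr // mulrC.
have c1 : (t * dirichlet_partial (fun=> 1) (1 + t) N : R) @[N --> \oo] --> t * zeta (1 + t).
  apply: cvgMl_tmp; apply: dirichlet_cvg; last by lra.
  by move=> n _; rewrite normr1.
have c2 : (1 - N.+1%:R `^ (- t) : R) @[N --> \oo] --> (1 - 0 : R).
  apply: cvgB; first exact: cvg_cst.
  by have := nat_powR_cvg0 t0; rewrite -cvg_shiftS.
rewrite -[X in X <= _]subr0; apply: ler_cvg_to c2 c1 _.
near=> N; apply: le_trans (sum_powR_ge N t0) _.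
rewrite ler_pM2l // /dirichlet_partial.
by apply: ler_sum => n _; rewrite mul1r.
Unshelve. all: by end_near. Qed.

End DirichletSeries.

Lemma prime_dvd_fact (p n : nat) : prime p -> (p %| n`!)%N -> (p <= n)%N.
Proof.
move=> pp; elim: n => [|n IH].
  by rewrite fact0 dvdn1 => /eqP p1; rewrite p1 in pp.
by rewrite factS Euclid_dvdM // => /orP[/dvdn_leq -> //|/IH /leqW].
Qed.

(** * Removal of Euler factors, positivity, and monotonicity of quotients *)

Section EulerProduct.
Variable R : realType.
Implicit Types (f g : nat -> R) (s t : R).

Definition completely_multiplicative f :=
  f 1%N = 1 /\
  forall m n : nat, (0 < m)%N -> (0 < n)%N -> f (m * n)%N = f m * f n.

Lemma restrict_coprime_bounded m f : bounded_by1 f ->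
  bounded_by1 (restrict_coprime m f).
Proof.
by move=> fb n n0; rewrite /restrict_coprime; case: ifP => _; rewrite ?fb ?normr0.
Qed.

Lemma restrict_coprime_mult m f : completely_multiplicative f ->
  completely_multiplicative (restrict_coprime m f).
Proof.
move=> [f1 fM]; split; first by rewrite /restrict_coprime coprimen1.
move=> i j i0 j0; rewrite /restrict_coprime coprimeMr.
by do 2 case: (coprime m _); rewrite /= ?mulr0 ?mul0r ?fM.
Qed.

Lemma restrict_coprime1 f : restrict_coprime 1 f = f.
Proof. by apply/funext => n; rewrite /restrict_coprime coprime1n. Qed.

Lemma restrict_coprime_dvd m p f : (p %| m)%N ->
  restrict_coprime (m * p) f = restrict_coprime m f.
Proof.
move=> pm; apply/funext => n; rewrite /restrict_coprime coprimeMl.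
by case: (boolP (coprime m n)) => //= /(coprime_dvdl pm) ->.
Qed.

Lemma sum_multiples (F : nat -> R) (p N : nat) : (0 < p)%N ->
  \sum_(1 <= n < (p * N).+1 | (p %| n)%N) F n = \sum_(1 <= k < N.+1) F (p * k)%N.
Proof.
move=> p0; elim: N => [|N IH]; first by rewrite muln0 !big_geq.
rewrite [RHS]big_nat_recr //= -IH (@big_cat_nat _ _ _ (p * N).+1) //=; last by nia.
congr (_ + _).
rewrite (_ : (p * N.+1).+1 = (p * N + p.-1).+2); last by nia.
rewrite big_mkcond big_nat_recr /=; last by lia.
rewrite (_ : (p * N + p.-1).+1 = p * N.+1)%N; last by nia.
rewrite dvdn_mulr // big_nat_cond big1 ?add0r // => i /andP[/andP[i1 i2] _].
case: ifP => // /dvdnP[k kE]; exfalso.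
have : (N < k)%N by rewrite -(ltn_pmul2l p0); lia.
have : (k < N.+1)%N by rewrite -(ltn_pmul2l p0); nia.
lia.
Qed.

Lemma powR_prime_le_half (p : nat) s : 1 < s -> prime p ->
  (p%:R : R) `^ (- s) <= 2^-1.
Proof.
move=> s1 pp; have p1 := prime_gt1 pp.
apply: (@le_trans _ _ (p%:R `^ (-1))).
  by apply: powR_nat_le; [lia|lra].
rewrite powR_inv1 ?ler0n // lef_pV2 ?posrE ?ltr0n //; last by lia.
by rewrite ler_nat.
Qed.

Lemma euler_factor_ge f (p : nat) s : bounded_by1 f -> 1 < s -> prime p ->
  2^-1 <= 1 - f p * p%:R `^ (- s).
Proof.
move=> fb s1 pp; have := fb p (prime_gt0 pp); rewrite ler_norml => /andP[_ f1].
have := powR_prime_le_half s1 pp; have := powR_ge0 (p%:R : R) (- s).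
by move: (_ `^ _) => x x0 x1; nra.
Qed.

Lemma dirichlet_remove_prime f s (m p : nat) :
  completely_multiplicative f -> bounded_by1 f -> 1 < s -> prime p ->
  coprime m p ->
  dirichlet_series (restrict_coprime (m * p) f) s =
  (1 - f p * p%:R `^ (- s)) * dirichlet_series (restrict_coprime m f) s.
Proof.
move=> [f1 fM] fb s1 pp cmp; have p0 := prime_gt0 pp.
set g := restrict_coprime m f.
have gb : bounded_by1 g := restrict_coprime_bounded m fb.
have hb := restrict_coprime_bounded (m * p) fb.
(* Along the bounds [p * N] the multiples of [p] are exactly the [p * k] with [k <= N]. *)
have sub : (p * N)%N @[N --> \oo] --> \oo.
  apply/cvgnyPge => A; exists A => // n /= An; nia.
have cg := cvg_comp _ _ sub (dirichlet_cvg gb s1).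
have ch := cvg_comp _ _ sub (dirichlet_cvg hb s1).
rewrite -(cvg_lim _ ch) //; apply: cvg_lim => //.
rewrite (_ : _ \o _ = fun N => dirichlet_partial g s (p * N) -
   f p * p%:R `^ (- s) * dirichlet_partial g s N); last first.
  apply/funext => N /=; rewrite /dirichlet_partial.
  rewrite [X in _ = X - _](bigID (fun n => (p %| n)%N)) /= sum_multiples //.
  rewrite [X in _ = X + _ - _](_ : _ = f p * p%:R `^ (- s) *
     \sum_(1 <= n < N.+1) g n * n%:R `^ (- s)).
    rewrite addrAC subrr add0r [RHS]big_mkcond; apply: eq_big_nat => n /andP[n1 _].
    rewrite /g /restrict_coprime coprimeMl (prime_coprime _ pp).
    by case: (p %| n)%N; rewrite ?andbF ?andbT ?mul0r.
  rewrite big_distrr /=; apply: eq_big_nat => n /andP[n1 _].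
  rewrite /g /restrict_coprime coprimeMr cmp /= fM // natrM powRM ?ler0n //.
  by case: (coprime m n); rewrite ?mul0r ?mulr0 // mulrACA.
rewrite mulrBl mul1r; apply: cvgB; first exact: cg.
by apply: cvgMl_tmp; apply: dirichlet_cvg.
Qed.

Definition euler_product f s (N : nat) : R :=
  \prod_(1 <= p < N.+1 | prime p) (1 - f p * p%:R `^ (- s)).

Lemma euler_product_gt0 f s N : bounded_by1 f -> 1 < s -> 0 < euler_product f s N.
Proof.
move=> fb s1; apply: prodr_gt0 => p pp.
by apply: lt_le_trans (euler_factor_ge fb s1 pp); rewrite invr_gt0.
Qed.

(** Passing from [N] to [N + 1] multiplies the modulus by [N + 1]: a prime removes one new factor,
    while the prime factors of a composite number already divide the factorial. *)
Lemma dirichlet_euler_product f s (N : nat) :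
  completely_multiplicative f -> bounded_by1 f -> 1 < s ->
  dirichlet_series (restrict_coprime N`! f) s =
  euler_product f s N * dirichlet_series f s.
Proof.
move=> fM fb s1; elim: N => [|N IH].
  by rewrite fact0 restrict_coprime1 /euler_product big_geq // mul1r.
rewrite factS mulnC /euler_product big_mkcond big_nat_recr //= -big_mkcond /=.
case: ifPn => [pN|npN].
  rewrite dirichlet_remove_prime //; last first.
    rewrite coprime_sym prime_coprime //; apply/negP.
    by move=> /(prime_dvd_fact pN); rewrite ltnn.
  by rewrite IH mulrA [X in X * _]mulrC.
rewrite mulr1 -IH; congr dirichlet_series; case: N npN {IH} => [|N] npN.
  by rewrite fact0 muln1.
apply/funext => n; rewrite /restrict_coprime coprimeMl.
case: (boolP (coprime _ n)) => //= cn; rewrite (_ : coprime _ n) //.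
have /primePn[|[q /andP[q1 q2] qN]] := npN; first by [].
have /dvdnP[r rE] := qN.
have r1 : (0 < r <= N.+1)%N by nia.
rewrite rE coprimeMl; apply/andP; split; apply: coprime_dvdl cn; apply: dvdn_fact; lia.
Qed.

(** No integer from 2 to [N] is prime to the factorial of [N], so beyond the first term only a tail
    remains. *)
Lemma dirichlet_fact_cvg f s : completely_multiplicative f -> bounded_by1 f -> 1 < s ->
  dirichlet_series (restrict_coprime N`! f) s @[N --> \oo] --> (1 : R).
Proof.
move=> [f1 fM] fb s1; have t0 : 0 < s - 1 by rewrite subr_gt0.
apply/cvgrPdist_le => e e0.
have c0 : (n%:R `^ (- (s - 1)) / (s - 1) : R) @[n --> \oo] --> (0 / (s - 1) : R).
  by apply: cvgMr_tmp; apply: nat_powR_cvg0.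
rewrite mul0r in c0; have {c0}/cvgrPdist_le/(_ e e0) c0 := c0.
near=> N.
have N0 : (0 < N)%N by near: N; exists 1%N.
have := @dirichlet_tail R (restrict_coprime N`! f) (s - 1) s N (restrict_coprime_bounded _ fb) t0.
rewrite addrC subrK => /(_ (lexx _) N0).
rewrite /dirichlet_partial big_nat_recl //= big1_seq ?addr0.
  rewrite /restrict_coprime coprimen1 f1 mul1r powR1 distrC => /le_trans; apply.
  have : `|0 - N%:R `^ (- (s - 1)) / (s - 1)| <= e by near: N.
  by rewrite sub0r normrN; apply: le_trans; rewrite ler_norm.
move=> i /andP[_]; rewrite mem_index_iota => /andP[i1 i2].
rewrite /restrict_coprime (_ : coprime _ _ = false) ?mul0r //.
apply/negbTE/negP => /(coprime_dvdl (dvdn_fact (_ : (0 < i.+1 <= N)%N))).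
rewrite /coprime gcdnn => /(_ _)/eqP; lia.
Unshelve. all: by end_near. Qed.

(** Some finite Euler product, which is positive, times the series is close to 1. *)
Lemma dirichlet_gt0 f s : completely_multiplicative f -> bounded_by1 f -> 1 < s ->
  0 < dirichlet_series f s.
Proof.
move=> fM fb s1.
have /cvgr_gt/(_ 0 ltr01) := dirichlet_fact_cvg fM fb s1.
move=> [N _ /(_ N (leqnn N))] /=; rewrite dirichlet_euler_product //.
by rewrite pmulr_rgt0 ?euler_product_gt0.
Qed.

(* Each Euler factor (1 - f(p) p^-s) / (1 - g(p) p^-s) of g's series over f's
   is nonincreasing in s. *)
Lemma dirichlet_ratio_le f g s t :
  completely_multiplicative f -> bounded_by1 f ->
  completely_multiplicative g -> bounded_by1 g ->
  (forall p, prime p -> f p <= g p) -> 1 < s -> s <= t ->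
  dirichlet_series g t / dirichlet_series f t <=
  dirichlet_series g s / dirichlet_series f s.
Proof.
move=> fM fb gM gb fg s1 st; have t1 : 1 < t by lra.
rewrite ler_pdivrMr ?dirichlet_gt0 // mulrAC ler_pdivlMr ?dirichlet_gt0 //.
set X := _ * _; set Y := _ * _.
(* After cross-multiplication the claim is [X <= Y]. Both [X * a N] and [Y * b N] tend to 1, and
   [b N <= a N] holds prime by prime, so [X / Y <= 1] in the limit. *)
have Y0 : 0 < Y by rewrite mulr_gt0 // dirichlet_gt0.
pose a N := euler_product g t N * euler_product f s N.
pose b N := euler_product g s N * euler_product f t N.
have ba N : b N <= a N.
  rewrite /a /b /euler_product -!big_split /=; apply: ler_prod => p pp.
  have e1 (h : nat -> R) (u : R) : bounded_by1 h -> 1 < u -> 0 <= 1 - h p * p%:R `^ (- u).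
    move=> hb u1; apply: (le_trans _ (euler_factor_ge hb u1 pp)).
    by rewrite invr_ge0.
  rewrite mulr_ge0 ?e1 //=.
  have := powR_nat_le (prime_gt0 pp) st; have := fg p pp.
  by move: (f p) (g p) (_ `^ _) (_ `^ _) => u v x y uv xy; nra.
have ca : X * a N @[N --> \oo] --> (1 * 1 : R).
  rewrite (_ : (fun N => _) = (fun N => dirichlet_series (restrict_coprime N`! g) t *
     dirichlet_series (restrict_coprime N`! f) s)).
    by apply: cvgM; apply: dirichlet_fact_cvg.
  by apply/funext => N; rewrite !dirichlet_euler_product // /X /a; ring.
have cb : Y * b N @[N --> \oo] --> (1 * 1 : R).
  rewrite (_ : (fun N => _) = (fun N => dirichlet_series (restrict_coprime N`! g) s *
     dirichlet_series (restrict_coprime N`! f) t)).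
    by apply: cvgM; apply: dirichlet_fact_cvg.
  by apply/funext => N; rewrite !dirichlet_euler_product // /Y /b; ring.
have cb' : X / Y * (Y * b N) @[N --> \oo] --> (X / Y * (1 * 1) : R) by apply: cvgMl_tmp.
have X0 : 0 < X by rewrite mulr_gt0 // dirichlet_gt0.
have := ler_cvg_to cb' ca; rewrite mulr1 mulr1 ler_pdivrMr // mul1r; apply.
near=> N; rewrite mulrA divfK ?gt_eqF // ler_pM2l //.
Unshelve. all: by end_near. Qed.

End EulerProduct.

(** * Continuity of Dirichlet series in the exponent *)

Section Continuity.
Variable R : realType.
Implicit Types (a f g : nat -> R) (s t : R).

Lemma continuous_dirichlet_partial a (m : nat) : continuous (dirichlet_partial a ^~ m).
Proof.
elim: m => [|m IH] s.
  rewrite (_ : _ ^~ _ = fun=> 0); first exact: cvg_cst.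
  by apply/funext => u; rewrite /dirichlet_partial big_geq.
rewrite (_ : _ ^~ _ = fun u => dirichlet_partial a u m + a m.+1 * m.+1%:R `^ (- u)); last first.
  by apply/funext => u; rewrite /dirichlet_partial big_nat_recr.
apply: cvgD; first exact: IH.
have c : (- u * ln m.+1%:R : R) @[u --> s] --> - s * ln m.+1%:R.
  by apply: cvgMr_tmp; apply: cvgN; exact: cvg_id.
apply: cvgMl_tmp; rewrite /powR pnatr_eq0 /=.
exact: (cvg_comp _ _ c (@continuous_expR _ _)).
Qed.

(** A three-epsilon argument: [t] is half of [s - 1], so that one partial sum approximates the
    series uniformly near [s]. *)
Lemma continuous_dirichlet a s : bounded_by1 a -> 1 < s ->
  {for s, continuous (dirichlet_series a)}.
Proof.
move=> ab s1; apply/cvgrPdist_le => e e0.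
pose t := (s - 1) / 2; have t0 : 0 < t by rewrite /t; lra.
have e3 : 0 < e / 3 by lra.
have [m m0 mt] : exists2 m : nat, (0 < m)%N & (m%:R : R) `^ (- t) / t <= e / 3.
  have c0 : (n%:R `^ (- t) / t : R) @[n --> \oo] --> (0 / t : R).
    by apply: cvgMr_tmp; apply: nat_powR_cvg0.
  rewrite mul0r in c0; have /cvgr_le/(_ _ e3) [N _ NP] := c0.
  by exists N.+1 => //; apply: NP => /=.
have := @continuous_dirichlet_partial a m s => /cvgrPdist_le/(_ _ e3) cm.
have ts : 1 + t < s by rewrite /t; lra.
have nt : \forall u \near s, 1 + t <= u.
  by apply: (@cvgr_ge R _ (nbhs s) _ idfun s) => //; exact: cvg_id.
near=> u.
have us : 1 + t <= u by near: u.
have ss : 1 + t <= s by rewrite /t; lra.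
have H1 := le_trans (dirichlet_tail ab t0 us m0) mt.
have H2 := le_trans (dirichlet_tail ab t0 ss m0) mt.
have H3 : `|dirichlet_partial a s m - dirichlet_partial a u m| <= e / 3 by near: u.
rewrite distrC in H1.
have -> : dirichlet_series a s - dirichlet_series a u =
  (dirichlet_series a s - dirichlet_partial a s m) +
  (dirichlet_partial a s m - dirichlet_partial a u m) +
  (dirichlet_partial a u m - dirichlet_series a u) by ring.
apply: (le_trans (ler_normD _ _)); apply: (le_trans (lerD (ler_normD _ _) (lexx _))).
lra.
Unshelve. all: by end_near. Qed.

End Continuity.

(** * Summation by parts and periodic sums *)

Section BoundNearOne.
Variable R : realType.
Implicit Types (a f g : nat -> R) (s t : R).

Lemma abel_bound (a b : nat -> R) (K : R) (N : nat) :
  (forall n, `|\sum_(1 <= i < n.+1) a i| <= K) ->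
  (forall n, (0 < n)%N -> b n.+1 <= b n) -> (forall n, 0 <= b n) ->
  `|\sum_(1 <= i < N.+1) a i * b i| <= K * b 1%N.
Proof.
move=> aK bd b0.
have K0 : 0 <= K by apply: le_trans (aK 0%N).
case: N => [|N]; first by rewrite big_geq // normr0 mulr_ge0.
(* Subtracting the boundary term of the summation by parts gives a statement that passes through the
   induction. *)
have H : `|\sum_(1 <= i < N.+2) a i * b i - (\sum_(1 <= i < N.+2) a i) * b N.+1|
          <= K * (b 1%N - b N.+1).
  elim: N => [|N IH]; first by rewrite !big_nat1 !subrr normr0 mulr0.
  rewrite big_nat_recr //= [in X in _ - X * _]big_nat_recr //=.
  set A := \sum_(1 <= i < N.+2) a i in IH *.
  set S := \sum_(1 <= i < N.+2) a i * b i in IH *.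
  have -> : S + a N.+2 * b N.+2 - (A + a N.+2) * b N.+2 =
     (S - A * b N.+1) + A * (b N.+1 - b N.+2) by ring.
  apply: (le_trans (ler_normD _ _)).
  have := bd N.+1 isT; rewrite -subr_ge0 normrM => bN; rewrite (ger0_norm bN).
  have := ler_wpM2r bN (aK N.+1); rewrite -/A; lra.
have := ler_wpM2r (b0 N.+1) (aK N.+1).
move: H; set A := \sum_(1 <= i < N.+2) a i; set S := \sum_(1 <= i < _) _.
move=> H HA; rewrite -(subrK (A * b N.+1) S).
apply: (le_trans (ler_normD _ _)); rewrite [`|A * _|]normrM (ger0_norm (b0 _)).
lra.
Qed.

Lemma periodic_sum_bound (h : nat -> R) (M n : nat) : (0 < M)%N ->
  (forall n, h (n + M)%N = h n) -> \sum_(i < M) h i = 0 ->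
  (forall n, `|h n| <= 1) -> `|\sum_(i < n) h i| <= M%:R.
Proof.
move=> M0 hp hs h1.
have [k] := ubnP n; elim: k n => // k IH n nk.
have [nM|Mn] := ltnP n M.
  apply: (le_trans (ler_norm_sum _ _ _)).
  apply: (@le_trans _ _ (\sum_(i < n) 1)); first exact: ler_sum.
  by rewrite sumr_const card_ord ler_nat ltnW.
have -> : \sum_(i < n) h i = \sum_(i < M + (n - M)) h i by rewrite subnKC.
rewrite big_split_ord /= hs add0r.
under eq_bigr do rewrite addnC hp.
by apply: IH; lia.
Qed.

End BoundNearOne.

(** * Behaviour near 1 and explicit bounds *)

Section Bounds.
Variable R : realType.
Implicit Types (a f g : nat -> R) (s t : R).

(** The partial sums of [h] are bounded by [M] and the weights decrease from 1, so summation by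
    parts gives a bound independent of [s], hence valid up to 1. *)
Lemma dirichlet_periodic_bound (h : nat -> R) (M : nat) s : (0 < M)%N ->
  (forall n, h (n + M)%N = h n) -> \sum_(i < M) h i = 0 -> h 0%N = 0 ->
  (forall n, `|h n| <= 1) -> 1 < s -> dirichlet_series h s <= M%:R.
Proof.
move=> M0 hp hs h0 h1 s1.
have hb : bounded_by1 h by move=> n _.
apply: cvgr_to_le (dirichlet_cvg hb s1) _.
near=> N; apply: (le_trans (ler_norm _)).
have -> : M%:R = M%:R * 1%:R `^ (- s) :> R by rewrite powR1 mulr1.
apply: (@abel_bound R h (fun n => n%:R `^ (- s))).
- move=> n; have := periodic_sum_bound n.+1 M0 hp hs h1.
  by rewrite big_ord_recl h0 add0r big_add1 big_mkord.
- move=> n n0; rewrite powRN powRN lef_pV2 ?posrE ?powR_gt0 ?ltr0n //.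
  by apply: ge0_ler_powR; rewrite ?nnegrE ?ler0n ?ler_nat //; lra.
- by move=> n; exact: powR_ge0.
Unshelve. all: by end_near. Qed.

(** Each distinct prime factor of [m] costs an Euler factor of at least one half, whatever [s]
    is. *)
Lemma dirichlet_restrict_ge f (m : nat) : completely_multiplicative f -> bounded_by1 f ->
  (0 < m)%N -> exists2 c : R, 0 < c &
  forall s, 1 < s -> c * dirichlet_series f s <= dirichlet_series (restrict_coprime m f) s.
Proof.
move=> fM fb; have [k] := ubnP m; elim: k m => // k IH m mk m0.
have [m1|m1] := leqP m 1.
  have -> : m = 1%N by lia.
  by exists 1 => // s s1; rewrite mul1r restrict_coprime1.
pose p := pdiv m; have pp : prime p := pdiv_prime m1.
have /dvdnP[r mE] := pdiv_dvd m; rewrite -/p in mE.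
have p1 := prime_gt1 pp.
have [c c0 Hc] : exists2 c : R, 0 < c &
  forall s, 1 < s -> c * dirichlet_series f s <= dirichlet_series (restrict_coprime r f) s.
  by apply: IH; nia.
have [pr|npr] := boolP (p %| r)%N.
  by exists c => // s s1; rewrite mE restrict_coprime_dvd // Hc.
exists (2^-1 * c) => [|s s1]; first by rewrite mulr_gt0 ?invr_gt0.
rewrite mE dirichlet_remove_prime //; last by rewrite coprime_sym prime_coprime.
rewrite -mulrA; apply: ler_pM; rewrite ?invr_ge0 ?Hc ?euler_factor_ge //.
by rewrite mulr_ge0 ?ltW // dirichlet_gt0.
Qed.

Lemma zeta_dominates f (m : nat) (K C : R) :
  completely_multiplicative f -> bounded_by1 f -> (0 < m)%N -> 0 <= C ->
  (forall s, 1 < s -> dirichlet_series (restrict_coprime m f) s <= K) ->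
  exists2 s, 1 < s < 2 & C * dirichlet_series f s ^+ 2 < zeta s ^+ 2.
Proof.
move=> fM fb m0 C0 fK; have [c c0 Hc] := dirichlet_restrict_ge fM fb m0.
have s2 : 1 < 2 :> R by lra.
have K0 : 0 <= K / c.
  rewrite divr_ge0 ?ltW //; apply: lt_le_trans (fK 2 s2).
  by apply: dirichlet_gt0 => //; [exact: restrict_coprime_mult|exact: restrict_coprime_bounded].
(* At [1 + u^-1] zeta is at least [u], while [f] has series at most [K / c]. The choice of [u] makes
   [u ^+ 2] exceed [C * (K / c) ^+ 2], and [2 <= u] keeps the point below 2. *)
pose u := (1 + C) * (K / c) + 2; have u2 : 2 <= u by rewrite lerDr mulr_ge0 // addr_ge0.
have u0 : 0 < u by lra.
have ui : 0 < u^-1 by rewrite invr_gt0.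
exists (1 + u^-1).
  rewrite ltrDl ui /=.
  have : u^-1 <= 2^-1 by rewrite lef_pV2 ?posrE.
  lra.
have s1 : 1 < 1 + u^-1 by lra.
have zu := zeta_ge ui; rewrite invrK in zu.
have L0 := dirichlet_gt0 fM fb s1.
have : dirichlet_series f (1 + u^-1) <= K / c.
  by rewrite ler_pdivlMr // mulrC (le_trans (Hc _ s1)) // fK.
move: L0 zu; move: (zeta _) (dirichlet_series _ _) => z L L0 zu LK.
apply: (@lt_le_trans _ _ (u ^+ 2)); last by rewrite ler_sqr ?nnegrE //; lra.
apply: (@le_lt_trans _ _ (C * (K / c) ^+ 2)).
  by rewrite ler_wpM2l // ler_sqr ?nnegrE // ltW.
rewrite /u; move: (K / c) K0 {LK u u2 u0 ui s1 zu} => k K0.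
have : 0 <= C * k by rewrite mulr_ge0.
have : 0 <= k ^+ 2 by rewrite sqr_ge0.
have : 0 <= C * k ^+ 2 by rewrite mulr_ge0 ?sqr_ge0.
have : 0 <= (C * k) ^+ 2 by rewrite sqr_ge0.
have -> : ((1 + C) * k + 2) ^+ 2 = k ^+ 2 + 2 * (C * k ^+ 2) + (C * k) ^+ 2
   + 4 * k + 4 * (C * k) + 4 by ring.
lra.
Qed.

Lemma one_bounded : bounded_by1 (fun=> 1 : R).
Proof. by move=> n _; rewrite normr1. Qed.

Lemma one_mult : completely_multiplicative (fun=> 1 : R).
Proof. by split => // m n _ _; rewrite mulr1. Qed.

Lemma dirichlet_le a g s : bounded_by1 a -> bounded_by1 g -> 1 < s ->
  (forall n, (0 < n)%N -> a n <= g n) -> dirichlet_series a s <= dirichlet_series g s.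
Proof.
move=> ab gb s1 ag; apply: ler_cvg_to (dirichlet_cvg ab s1) (dirichlet_cvg gb s1) _.
near=> N; apply: ler_sum_nat => n /andP[n1 _].
by rewrite ler_wpM2r ?powR_ge0 ?ag.
Unshelve. all: by end_near. Qed.

Lemma dirichlet_restrict_le f s (m : nat) : bounded_by1 f -> 1 < s ->
  dirichlet_series (restrict_coprime m f) s <=
  dirichlet_series (restrict_coprime m (fun=> 1)) s.
Proof.
move=> fb s1; apply: dirichlet_le => //; try exact: restrict_coprime_bounded.
  exact/restrict_coprime_bounded/one_bounded.
move=> n n0; rewrite /restrict_coprime; case: ifP => // _.
by have := fb n n0; rewrite ler_norml => /andP[].
Qed.

(** The coefficients [f n + 1] are nonnegative and the first one is 2. This turns upper bounds for
    zeta into lower bounds for the series of [f]. *)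
Lemma dirichlet_restrict_sum_ge2 f s (m : nat) : completely_multiplicative f ->
  bounded_by1 f -> 1 < s ->
  2 <= dirichlet_series (restrict_coprime m f) s +
       dirichlet_series (restrict_coprime m (fun=> 1)) s.
Proof.
move=> [f1 fM] fb s1; have b1 := restrict_coprime_bounded m fb.
have b2 := restrict_coprime_bounded m one_bounded.
apply: cvgr_to_ge (cvgD (dirichlet_cvg b1 s1) (dirichlet_cvg b2 s1)) _.
near=> N.
have N0 : (0 < N)%N by near: N; exists 1%N.
change (2 <= dirichlet_partial (restrict_coprime m f) s N +
  dirichlet_partial (restrict_coprime m (fun=> 1)) s N).
rewrite /dirichlet_partial -big_split /=.
rewrite big_ltn // -mulrDl /restrict_coprime coprimen1 f1 powR1 mulr1 lerDl.
rewrite big_nat; apply: sumr_ge0 => n /andP[n1 _]; rewrite -mulrDl mulr_ge0 ?powR_ge0 //.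
case: ifP => // _; first by have := fb n (ltnW n1); rewrite ler_norml => /andP[]; lra.
Unshelve. all: by end_near. Qed.

Lemma odd_zeta_le s (c : R) : 1 < s ->
  (forall k, (0 < k)%N -> (k.*2.+1%:R : R) `^ (- s) <= c / (4 * k%:R * k.+1%:R)) ->
  dirichlet_series (restrict_coprime 2 (fun=> 1)) s <= 1 + c / 4.
Proof.
move=> s1 kc.
have c0 : 0 <= c.
  have := le_trans (powR_ge0 _ _) (kc 1%N isT).
  by rewrite mulr1 pmulr_lge0 // invr_gt0; lra.
have b := restrict_coprime_bounded 2 one_bounded.
have sub : (2 * N)%N @[N --> \oo] --> \oo.
  by apply/cvgnyPge => A; exists A => // n /= An; lia.
apply: cvgr_to_le (cvg_comp _ _ sub (dirichlet_cvg b s1)) _.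
near=> N; have N0 : (0 < N)%N by near: N; exists 1%N.
(* The sum of [1 / (k (k + 1))] over [0 < k < N] telescopes to [1 - 1 / N], and the even terms
   vanish. *)
rewrite /=; apply: (@le_trans _ _ (1 + c / 4 * (1 - N%:R^-1))); last first.
  by rewrite lerD2l ler_piMr ?divr_ge0 // gerBl invr_ge0.
move: N0; clear - kc c0; case: N => // N _; elim: N => [|N IH].
  rewrite /dirichlet_partial muln1 big_nat_recr //= big_nat1.
  by rewrite /restrict_coprime /= invr1 subrr mulr0 addr0 mul0r addr0 powR1 mulr1.
have [m mE] : exists m, m = (2 * N.+1)%N by eexists.
rewrite (_ : (2 * N.+2 = m.+2)%N); last by lia.
have := kc N.+1 isT; rewrite -mul2n -mE => k1; rewrite -mE in IH.
have c2 : coprime 2 m.+2 = false by rewrite coprime2n mE; lia.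
have c1 : coprime 2 m.+1 by rewrite coprime2n mE; lia.
rewrite /dirichlet_partial big_nat_recr //= big_nat_recr //=.
rewrite [X in _ + X * _ + _]/restrict_coprime [X in _ + X * _]/restrict_coprime.
rewrite c1 c2 mul0r addr0 mul1r.
apply: (le_trans (lerD IH k1)).
rewrite le_eqVlt; apply/orP; left; apply/eqP.
have n1 : N.+1%:R != 0 :> R by rewrite pnatr_eq0.
have n2 : N.+2%:R != 0 :> R by rewrite pnatr_eq0.
have E : N.+2%:R = N.+1%:R + 1 :> R by rewrite natr1.
rewrite E in n2 *; move: n1 n2; move: (N.+1%:R) => x x0 x1.
by field; rewrite x0 x1.
Unshelve. all: by end_near. Qed.

Lemma odd_zeta2_le : dirichlet_series (restrict_coprime 2 (fun=> 1)) 2 <= 5 / 4 :> R.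
Proof.
have -> : 5 / 4 = 1 + 1 / 4 :> R by lra.
apply: odd_zeta_le; first by lra.
move=> k k0; rewrite powR_invn ?ler0n // mul1r lef_pV2 ?posrE.
- by rewrite -!natrM -natrX ler_nat; lia.
- by rewrite exprn_gt0 ?ltr0n.
- by rewrite -!natrM ltr0n; lia.
Qed.

Lemma odd_zeta3_le : dirichlet_series (restrict_coprime 2 (fun=> 1)) 3 <= 13 / 12 :> R.
Proof.
(* The constant is one third because [(2k+1)^2 >= 4k(k+1)] and [2k+1 >= 3]. *)
have -> : 13 / 12 = 1 + 3^-1 / 4 :> R by lra.
apply: odd_zeta_le; first by lra.
move=> k k0; rewrite powR_invn ?ler0n // -invfM lef_pV2 ?posrE.
- by rewrite -!natrM -natrX ler_nat; nia.
- by rewrite exprn_gt0 ?ltr0n.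
- by rewrite -!natrM ltr0n; lia.
Qed.

End Bounds.

(** * Partial fractions of the squared cosecant *)

Section CosecantSquared.
Variable R : realType.
Implicit Types x y z : R.

Lemma sin_le_id z : 0 < z -> sin z <= z.
Proof.
move=> z0.
have [|c _] := @MVT R sin cos 0 z z0 (fun x _ => is_derive_sin x).
  exact/continuous_subspaceT/continuous_sin.
rewrite sin0 !subr0 => ->; rewrite ler_piMl ?cos_le1 //; exact: ltW.
Qed.

Lemma id_le_tan z : 0 < z -> z < pi / 2 -> z <= tan z.
Proof.
move=> z0 zp.
have cpos x : x \in `[0, z] -> 0 < cos x.
  by rewrite in_itv /= => /andP[x0 xz]; apply: cos_gt0_pihalf; apply/andP; split; lra.
have [||c cz] := @MVT R tan (fun x => (cos x) ^- 2) 0 z z0.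
- move=> x xz; apply: is_derive_tan; rewrite gt_eqF // cpos //.
  by move: xz; rewrite !in_itv /= => /andP[? ?]; apply/andP; split; lra.
- apply: continuous_in_subspaceT => x; rewrite inE /= => xz.
  by apply: continuous_tan; rewrite gt_eqF // cpos.
have c0 : 0 < cos c.
  by apply: cpos; move: cz; rewrite !in_itv /= => /andP[? ?]; apply/andP; split; lra.
rewrite tan0 !subr0 => ->; rewrite ler_peMl ?(ltW z0) //.
by rewrite invf_ge1 ?exprn_gt0 // exprn_ile1 ?cos_le1 // ltW.
Qed.

(** Both sides come from [sin z <= z <= tan z], the squared cotangent being the squared cosecant
    minus 1. *)
Lemma csc2_bounds z : 0 < z -> z < pi / 2 ->
  (sin z) ^- 2 - 1 <= z ^- 2 <= (sin z) ^- 2.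
Proof.
move=> z0 zp.
have s0 : 0 < sin z by rewrite sin_gt0_pihalf ?z0.
have c0 : 0 < cos z by apply: cos_gt0_pihalf; apply/andP; split; lra.
apply/andP; split; last first.
  by rewrite lef_pV2 ?posrE ?exprn_gt0 // ler_sqr ?nnegrE ?(ltW s0) ?(ltW z0) // sin_le_id.
have -> : (sin z) ^- 2 - 1 = (tan z) ^- 2.
  rewrite /tan expr_div_n invf_div cos2sin2 mulrBl mul1r divff //.
  by rewrite expf_eq0 /= gt_eqF.
have t0 : 0 < tan z by rewrite divr_gt0.
by rewrite lef_pV2 ?posrE ?exprn_gt0 // ler_sqr ?nnegrE ?(ltW t0) ?(ltW z0) // id_le_tan.
Qed.

Lemma csc2_half z : sin z != 0 ->
  (sin z) ^- 2 = 4^-1 * ((sin (z / 2)) ^- 2 + (sin (z / 2 + pi / 2)) ^- 2).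
Proof.
move=> sz; rewrite sinDpihalf.
have zE : z = (z / 2) *+ 2 by rewrite mulr2n; lra.
rewrite [in LHS]zE sin_mulr2n.
have : cos (z / 2) * sin (z / 2) != 0.
  by apply: contra sz => /eqP E; rewrite zE sin_mulr2n E mul0rn.
rewrite mulf_eq0 negb_or => /andP[c0 s0].
have := cos2Dsin2 (z / 2).
move: (cos _) (sin _) c0 s0 => c s c0 s0 cs.
rewrite -mulr_natr; transitivity ((c ^+ 2 + s ^+ 2) / (4 * (c * s) ^+ 2)).
  by rewrite cs; field; rewrite c0 s0.
by field; rewrite c0 s0.
Qed.

Lemma csc2_dyadic x (N : nat) : 0 < x -> x < 1 ->
  (sin (pi * x)) ^- 2 = 4^-1 ^+ N *
    \sum_(k < 2 ^ N) (sin (pi * (x + k%:R) / 2 ^+ N)) ^- 2.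
Proof.
move=> x0 x1; elim: N => [|N IH].
  by rewrite big_ord1 expr0 mul1r addr0 divr1.
rewrite IH expnS mul2n -addnn big_split_ord /= exprSr -mulrA; congr (_ * _).
rewrite -big_split /= big_distrr; apply: eq_bigr => k _.
have p0 : 0 < 2 ^+ N :> R by rewrite exprn_gt0.
rewrite csc2_half; last first.
  rewrite gt_eqF // sin_gt0_pi //; apply/andP; split.
    by rewrite divr_gt0 ?mulr_gt0 ?pi_gt0 // ltr_wpDr ?ler0n.
  rewrite ltr_pdivrMr // ltr_pM2l ?pi_gt0 //.
  have : k.+1%:R <= (2 ^ N)%:R :> R by rewrite ler_nat.
  by rewrite natrX -natr1; lra.
congr (_ * (sin _ ^- 2 + sin _ ^- 2)).
  by rewrite exprS invfM; lra.
rewrite natrD natrX exprS; field; exact: lt0r_neq0.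
Qed.

(* Herglotz' half-angle argument, pairing k with 2^N - 1 - k so that every
   argument lies in ]0, pi/2[. *)
Lemma csc2_dyadic_sym x (N : nat) : 0 < x -> x < 1 ->
  (sin (pi * x)) ^- 2 = 4^-1 ^+ N.+1 * \sum_(k < 2 ^ N)
   ((sin (pi * (x + k%:R) / 2 ^+ N.+1)) ^- 2 +
    (sin (pi * (1 - x + k%:R) / 2 ^+ N.+1)) ^- 2).
Proof.
move=> x0 x1; rewrite (csc2_dyadic N.+1 x0 x1); congr (_ * _).
rewrite expnS mul2n -addnn big_split_ord big_split /=; congr (_ + _).
rewrite (reindex_inj rev_ord_inj) /=; apply: eq_bigr => k _.
have p0 : 2 ^+ N != 0 :> R by rewrite expf_neq0.
have -> : pi * (x + (2 ^ N + (2 ^ N - k.+1))%:R) / 2 ^+ N.+1 =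
          pi - pi * (1 - x + k%:R) / 2 ^+ N.+1 :> R.
  rewrite natrD natrB // natrX -natr1 exprS; field; exact: p0.
by rewrite sinB sinpi cospi mul0r sub0r mulN1r opprK.
Qed.

(** Replacing each of the [2 ^ N.+1] cosecant terms by a reciprocal square costs at most 1. With the
    prefactor [4^-1 ^+ N.+1] the total error is at most [2^-1 ^+ N.+1], and the sums are
    squeezed. *)
Lemma csc2_series x : 0 < x -> x < 1 ->
  \sum_(k < 2 ^ N) ((x + k%:R) ^- 2 + (1 - x + k%:R) ^- 2) @[N --> \oo] -->
  (pi ^+ 2 / sin (pi * x) ^+ 2 : R).
Proof.
move=> x0 x1; set c := sin (pi * x) ^- 2.
pose S N := \sum_(k < 2 ^ N) ((x + k%:R) ^- 2 + (1 - x + k%:R) ^- 2).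
have bounds N : pi ^+ 2 * (c - 2^-1 ^+ N.+1) <= S N <= pi ^+ 2 * c.
  have p0 : 0 < pi ^+ 2 :> R by rewrite exprn_gt0 ?pi_gt0.
  have q0 : 0 < 4 ^+ N.+1 :> R by rewrite exprn_gt0.
  have term y k : 0 < y -> y < 1 -> (k < 2 ^ N)%N ->
     (sin (pi * (y + k%:R) / 2 ^+ N.+1)) ^- 2 - 1 <=
     4 ^+ N.+1 / pi ^+ 2 * (y + k%:R) ^- 2 <=
     (sin (pi * (y + k%:R) / 2 ^+ N.+1)) ^- 2.
    move=> y0 y1 k2; have pp := @pi_gt0 R.
    have n0 : 0 < 2 ^+ N.+1 :> R by rewrite exprn_gt0.
    have yk : 0 < y + k%:R by rewrite ltr_wpDr ?ler0n.
    have -> : 4 ^+ N.+1 / pi ^+ 2 * (y + k%:R) ^- 2 =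
       (pi * (y + k%:R) / 2 ^+ N.+1) ^- 2.
      rewrite (_ : 4 = 2 * 2 :> R) ?exprMn -?expr2; last by lra.
      move: (2 ^+ N.+1) n0 (pi : R) pp (y + _) yk => q n0 p pp z yk.
      by field; rewrite !lt0r_neq0.
    apply: csc2_bounds; first by rewrite divr_gt0 ?mulr_gt0.
    rewrite ltr_pdivrMr // exprS mulrA divfK // ltr_pM2l //.
    have : k.+1%:R <= (2 ^ N)%:R :> R by rewrite ler_nat.
    by rewrite natrX -natr1; lra.
  have SE : 4 ^+ N.+1 / pi ^+ 2 * S N = \sum_(k < 2 ^ N)
     (4 ^+ N.+1 / pi ^+ 2 * (x + k%:R) ^- 2 + 4 ^+ N.+1 / pi ^+ 2 * (1 - x + k%:R) ^- 2).
    by rewrite big_distrr; apply: eq_bigr => k _; rewrite -mulrDr.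
  have x'0 : 0 < 1 - x by lra.
  have x'1 : 1 - x < 1 by lra.
  have cE := csc2_dyadic_sym N x0 x1; rewrite -/c in cE.
  have SN : S N = pi ^+ 2 * (4^-1 ^+ N.+1 * (4 ^+ N.+1 / pi ^+ 2 * S N)).
    have q : 4^-1 ^+ N.+1 * 4 ^+ N.+1 = 1 :> R by rewrite -exprMn mulVf ?expr1n.
    move: (S N) (pi ^+ 2) p0 => u v v0.
    by rewrite -!mulrA (mulrA (4^-1 ^+ N.+1)) q mul1r mulVKf // lt0r_neq0.
  have four : 0 <= 4^-1 ^+ N.+1 :> R by rewrite exprn_ge0 // invr_ge0.
  rewrite SN !ler_pM2l // SE; apply/andP; split; last first.
    rewrite cE ler_wpM2l //; apply: ler_sum => k _.
    by apply: lerD; [have /andP[] := term x k x0 x1 (ltn_ord k)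
      | have /andP[] := term (1 - x) k x'0 x'1 (ltn_ord k)].
  rewrite cE (_ : 2^-1 ^+ N.+1 = 4^-1 ^+ N.+1 * \sum_(k < 2 ^ N) (1 + 1)); last first.
    rewrite sumr_const card_ord -[X in _ = _ * X]mulr_natr natrX -[1 + 1]/(2%:R) -exprS.
    by rewrite -exprMn; congr (_ ^+ _); lra.
  rewrite -mulrBr -sumrB ler_wpM2l //; apply: ler_sum => k _.
  have /andP[+ _] := term x k x0 x1 (ltn_ord k).
  have /andP[+ _] := term (1 - x) k x'0 x'1 (ltn_ord k).
  lra.
apply: (@squeeze_cvgr _ _ _ _ (fun N => pi ^+ 2 * (c - 2^-1 ^+ N.+1)) (fun=> pi ^+ 2 * c)).
- by near=> N.
- rewrite -[X in _ --> X](_ : pi ^+ 2 * (c - 0) = _); last by rewrite subr0.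
  apply: cvgMl_tmp; apply: cvgB; first exact: cvg_cst.
  have := @cvg_expr R 2^-1; rewrite -cvg_shiftS; apply.
  by rewrite ger0_norm ?invr_ge0 //; lra.
- exact: cvg_cst.
Unshelve. all: by end_near. Qed.

End CosecantSquared.

(** * Small moduli *)

Section SmallCharacterValues.

(** Replaces the quantifier over ['I_p] by a search through a list, which evaluates for concrete [a]
    and [p]. *)
Lemma legendre_symbol_nat (a p : nat) : legendre_symbol a p =
  if (p %| a)%N then 0
  else if has (fun x => x ^ 2 == a %[mod p])%N (iota 0 p) then 1 else -1.
Proof.
rewrite /legendre_symbol dvdzE; case: ifP => // _; congr (if _ then _ else _).
have sqE (y : nat) : y%:Z ^+ 2 = (y ^ 2)%:Z by rewrite expr2 -PoszM mulnn.
apply/existsP/hasP => [[x xa]|[x]].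
  exists (x : nat); first by rewrite mem_iota /=.
  by move: xa; rewrite sqE !modz_nat eqz_nat.
rewrite mem_iota /= => xp xa; exists (Ordinal xp) => /=.
by rewrite sqE !modz_nat eqz_nat.
Qed.

Lemma chi_odd_prime (d p : nat) : prime p -> p != 2%N -> chi d p =
  if (p %| fund_disc d)%N then 0
  else if has (fun x => x ^ 2 == fund_disc d %[mod p])%N (iota 0 p) then 1 else -1.
Proof.
move=> pp p2; rewrite /chi kronecker_symbol_primeE // /kronecker_symbol_prime.
by rewrite (negbTE p2) legendre_symbol_nat.
Qed.

Lemma chi_prime2 (d : nat) : (d %% 4 != 1)%N -> chi d 2 = 0.
Proof.
move=> d4; rewrite /chi kronecker_symbol_primeE // /kronecker_symbol_prime eqxx.
by rewrite /fund_disc (negbTE d4) dvdzE /= dvdn_mulr.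
Qed.

Lemma chi5_prime2 : chi 5 2 = -1.
Proof. by rewrite /chi kronecker_symbol_primeE. Qed.

Definition chi3_table : seq int := [:: 0; 1; 0; 0; 0; -1; 0; -1; 0; 0; 0; 1].

(** The general period is 24, and restricting to integers prime to 24 changes nothing because the
    character vanishes at 2 and 3. The table is then checked on one period. *)
Lemma chi3_mod12 (n : nat) : (0 < n)%N -> chi 3 n = chi3_table`_(n %% 12).
Proof.
move=> n0; have sq3 : squarefree 3.
  by move=> [|[|m]] // /dvdn_leq; rewrite expnS expn1; nia.
set F := restrict_coprime 24 (chi 3).
have c2 : chi 3 2 = 0 by rewrite chi_prime2.
have c3 : chi 3 3 = 0 by rewrite chi_odd_prime.
have chiM i j : (0 < i)%N -> (0 < j)%N -> chi 3 (i * j) = chi 3 i * chi 3 j.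
  by move=> *; exact: kronecker_symbolM.
have -> : chi 3 n = F n.
  rewrite /F /restrict_coprime; case: ifPn => //.
  rewrite -[24%N]/(2 ^ 3 * 3)%N coprimeMl coprime_pexpl // !prime_coprime //.
  rewrite negb_and !negbK => /orP[]/dvdnP[k kE]; rewrite kE chiM ?c2 ?c3 ?mulr0 //;
    by move: n0; rewrite kE muln_gt0 andbT.
have -> : F n = F (n %% 24)%N.
  rewrite [in LHS](divn_eq n 24) addnC; elim: (n %/ 24)%N => [|i IH]; first by rewrite addn0.
  rewrite mulSn addnCA [(24 + _)%N]addnC -IH.
  exact: (@chi_periodic 3 isT sq3).
rewrite -(@modn_dvdm 24 n 12) //.
have : (n %% 24 < 24)%N by rewrite ltn_mod.
move: (n %% 24)%N => r r24.
have : all (fun r => F r == chi3_table`_(r %% 12)) (iota 0 24); last first.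
  by move/allP/(_ r); rewrite mem_iota r24 => /(_ isT)/eqP.
by rewrite /= /F /restrict_coprime /chi kronecker_symbol1
  -!/(chi 3 _) !chi_odd_prime.
Qed.

End SmallCharacterValues.

Section ModTwelve.
Variable R : realType.

(** In each block of twelve terms the residues 1 and 11 form the pair of [csc2_series] at
    [x = 1 / 12], and 5 and 7 the pair at [x = 5 / 12]. *)
Lemma dirichlet_mod12 (h : nat -> R) (c1 c5 : R) : bounded_by1 h ->
  (forall n, (0 < n)%N ->
     h n = [:: 0; c1; 0; 0; 0; c5; 0; c5; 0; 0; 0; c1]`_(n %% 12)) ->
  dirichlet_series h 2 =
  144^-1 * (c1 * (pi ^+ 2 / sin (pi * (1 / 12)) ^+ 2) +
            c5 * (pi ^+ 2 / sin (pi * (5 / 12)) ^+ 2)).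
Proof.
move=> hb hE; have s2 : 1 < 2 :> R by lra.
pose S (x : R) K := \sum_(k < K) ((x + k%:R) ^- 2 + (1 - x + k%:R) ^- 2).
have PE K : dirichlet_partial h 2 (12 * K) =
    144^-1 * (c1 * S (1 / 12) K + c5 * S (5 / 12) K).
  elim: K => [|K IH].
    by rewrite /dirichlet_partial muln0 big_geq // /S !big_ord0 !mulr0 addr0 mulr0.
  rewrite /S !big_ord_recr /= -!/(S _ _) -/(S _ _).
  have [m mE] : exists m, m = (12 * K)%N by eexists.
  have hm j : (0 < j)%N -> h (m + j)%N = [:: 0; c1; 0; 0; 0; c5; 0; c5; 0; 0; 0; c1]`_(j %% 12).
    by move=> j0; rewrite hE ?addn_gt0 ?j0 ?orbT // mE mulnC modnMDl.
  have pm j : (0 < j)%N -> (m + j)%:R `^ (- 2) = 144^-1 * (j%:R / 12 + K%:R) ^- 2 :> R.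
    move=> j0; rewrite powR_invn ?ler0n // natrD mE natrM.
    have : j%:R / 12 + K%:R != 0 :> R.
      by rewrite lt0r_neq0 // ltr_wpDr ?ler0n // divr_gt0 ?ltr0n.
    move=> nz; have -> : 12%:R * K%:R + j%:R = 12 * (j%:R / 12 + K%:R) :> R by lra.
    by rewrite exprMn invfM; congr (_ * _); lra.
  rewrite -mE in IH; rewrite mulnS -mE addnC.
  have -> : dirichlet_partial h 2 (m + 12) = dirichlet_partial h 2 m +
     \sum_(1 <= j < 13) h (m + j)%N * (m + j)%:R `^ (- 2).
    rewrite /dirichlet_partial (@big_cat_nat _ _ _ m.+1) //=; last by lia.
    congr (_ + _); rewrite -{1}add1n big_addn.
    rewrite (_ : ((m + 12).+1 - m = 13)%N); last by lia.
    by apply: eq_big_nat => i _; rewrite addnC.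
  rewrite IH.
  rewrite (eq_big_nat _ _ (F2 := fun j =>
    [:: 0; c1; 0; 0; 0; c5; 0; c5; 0; 0; 0; c1]`_(j %% 12) * (144^-1 * (j%:R / 12 + K%:R) ^- 2)));
    last by move=> i /andP[i1 _]; rewrite hm // pm.
  rewrite unlock /= !mul0r !add0r addr0.
  rewrite -/(S _ _).
  have -> : 1 - 1 / 12 = 11 / 12 :> R by lra.
  have -> : 1 - 5 / 12 = 7 / 12 :> R by lra.
  move: (S _ _) (S _ _) => S1 S5.
  ring.
have sub : (12 * 2 ^ N)%N @[N --> \oo] --> \oo.
  apply/cvgnyPge => A; exists A => // n /= An.
  by have := ltn_expl n (ltnSn 1); lia.
have ch := cvg_comp _ _ sub (dirichlet_cvg hb s2).
rewrite -(cvg_lim _ ch) //; apply: cvg_lim => //.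
rewrite (_ : _ \o _ = fun N => 144^-1 * (c1 * S (1 / 12) (2 ^ N)%N + c5 * S (5 / 12) (2 ^ N)%N)).
  by apply: cvgMl_tmp; apply: cvgD; apply: cvgMl_tmp; apply: csc2_series; lra.
by apply/funext => N /=.
Qed.

End ModTwelve.

(** * The null crossing *)

Section NullCrossing.
Variable R : realType.
Implicit Types (s t : R) (d : nat).

Let chiR d : nat -> R := fun n => (chi d n)%:~R.

Lemma LchiE d s : Lchi d s = dirichlet_series (chiR d) s.
Proof. by []. Qed.

Lemma chi_mult d : completely_multiplicative (chiR d).
Proof.
split; first by rewrite /chiR /chi kronecker_symbol1.
by move=> m n m0 n0; rewrite /chiR /chi kronecker_symbolM // rmorphM.
Qed.

Lemma chi_bounded d : bounded_by1 (chiR d).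
Proof.
move=> n n0; rewrite /chiR.
have := kronecker_cases (fund_disc d)%:Z n0; rewrite -/(chi d n) !inE.
by move=> /or3P[]/eqP->; rewrite ?normr0 ?normrN ?normr1.
Qed.

Lemma zeta_gt0 s : 1 < s -> 0 < zeta s.
Proof. by move=> s1; apply: dirichlet_gt0 => //; [exact: one_mult|exact: one_bounded]. Qed.

Lemma Lchi_gt0 d s : 1 < s -> 0 < Lchi d s.
Proof. by move=> s1; apply: dirichlet_gt0 => //; [exact: chi_mult|exact: chi_bounded]. Qed.

Lemma chi_dvd d p : prime p -> (p %| d)%N -> chi d p = 0.
Proof.
move=> pp pd; have [p2|p2] := eqVneq p 2%N.
  rewrite p2 in pd *; apply: chi_prime2; lia.
rewrite chi_odd_prime // (_ : (p %| fund_disc d)%N) //.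
by rewrite /fund_disc; case: ifP => // _; rewrite dvdn_mull.
Qed.

Lemma zeta_remove (m p : nat) s : 1 < s -> prime p -> coprime m p ->
  dirichlet_series (restrict_coprime (m * p) (fun=> 1)) s =
  (1 - p%:R `^ (- s)) * dirichlet_series (restrict_coprime m (fun=> 1)) s.
Proof.
move=> s1 pp mp; rewrite dirichlet_remove_prime ?mul1r //.
  exact: one_mult.
exact: one_bounded.
Qed.

Lemma Lchi_remove (m p : nat) d s : 1 < s -> prime p -> coprime m p ->
  dirichlet_series (restrict_coprime (m * p) (chiR d)) s =
  (1 - (chi d p)%:~R * p%:R `^ (- s)) *
  dirichlet_series (restrict_coprime m (chiR d)) s.
Proof.
by move=> s1 pp mp; rewrite dirichlet_remove_prime //; [exact: chi_mult|exact: chi_bounded].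
Qed.

(** Strictness comes from a prime [q] dividing [d]: there the character vanishes, so the quotient
    has the strictly decreasing factor [1 / (1 - q^-s)], and the rest is nonincreasing. *)
Lemma ratio_decreasing d s t : (1 < d)%N -> 1 < s -> s < t ->
  zeta t / Lchi d t < zeta s / Lchi d s.
Proof.
move=> d1 s1 st; have t1 : 1 < t by lra.
pose q := pdiv d; have pq : prime q := pdiv_prime d1.
have q1 := prime_gt1 pq.
pose r u := dirichlet_series (restrict_coprime (1 * q) (fun=> 1)) u /
            dirichlet_series (restrict_coprime (1 * q) (chiR d)) u : R.
have fac u : 1 < u -> 0 < 1 - q%:R `^ (- u) :> R.
  by move=> u1; have := powR_prime_le_half u1 pq; lra.
have rE u : 1 < u -> zeta u / Lchi d u = r u / (1 - q%:R `^ (- u)).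
  move=> u1; rewrite /r zeta_remove ?coprime1n // Lchi_remove ?coprime1n // chi_dvd ?pdiv_dvd // mul0r subr0 mul1r.
  rewrite !restrict_coprime1 -/(zeta u) -LchiE mulrAC (mulrAC (1 - _)) divff ?mul1r //.
  by rewrite lt0r_neq0 // fac.
have rpos u : 1 < u -> 0 < r u.
  move=> u1; rewrite divr_gt0 //; apply: dirichlet_gt0 => //.
  - exact/restrict_coprime_mult/one_mult.
  - exact/restrict_coprime_bounded/one_bounded.
  - exact/restrict_coprime_mult/chi_mult.
  - exact/restrict_coprime_bounded/chi_bounded.
have rle : r t <= r s.
  apply: dirichlet_ratio_le => //; last exact: ltW.
  - exact/restrict_coprime_mult/chi_mult.
  - exact/restrict_coprime_bounded/chi_bounded.
  - exact/restrict_coprime_mult/one_mult.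
  - exact/restrict_coprime_bounded/one_bounded.
  move=> p pp; rewrite /restrict_coprime; case: ifP => // _.
  by have := chi_bounded d (prime_gt0 pp); rewrite ler_norml => /andP[].
rewrite !rE //; apply: (@le_lt_trans _ _ (r s / (1 - q%:R `^ (- t)))).
  by rewrite ler_pM2r // invr_gt0 fac.
rewrite ltr_pM2l ?rpos // ltf_pV2 ?posrE ?fac // ltrD2l ltrN2.
rewrite /powR pnatr_eq0 gtn_eqF ?(ltnW q1) // ltr_expR.
by rewrite ltr_pM2r ?ltrN2 // ln_gt0 // ltr1n.
Qed.

Lemma null_crossing_eq_ratio d s : 1 < s ->
  zeta s ^+ 2 = d%:R * Lchi d s ^+ 2 <-> (zeta s / Lchi d s) ^+ 2 = d%:R.
Proof.
move=> s1; have L0 := lt0r_neq0 (Lchi_gt0 d s1).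
rewrite expr_div_n; split => [->|E]; first by rewrite mulfK // expf_neq0.
by rewrite -E divfK // expf_neq0.
Qed.

Lemma ratio_gt0 d s : 1 < s -> 0 < zeta s / Lchi d s.
Proof. by move=> s1; rewrite divr_gt0 ?zeta_gt0 ?Lchi_gt0. Qed.

Lemma null_crossing_eq_inj d s t : (1 < d)%N ->
  null_crossing_eq d s -> null_crossing_eq d t -> s = t.
Proof.
move=> d1 [s1 /(null_crossing_eq_ratio d s1) Es] [t1 /(null_crossing_eq_ratio d t1) Et].
have rst : zeta s / Lchi d s = zeta t / Lchi d t.
  apply/eqP; rewrite -(@eqrXn2 _ 2) ?Es ?Et ?ltW ?ratio_gt0 //.
have [st|ts|//] := ltgtP s t.
  by have := ratio_decreasing d1 s1 st; rewrite rst ltxx.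
by have := ratio_decreasing d1 t1 ts; rewrite rst ltxx.
Qed.

Lemma zeta_odd_part s : 1 < s -> (1 - 2 `^ (- s)) * zeta s =
  dirichlet_series (restrict_coprime 2 (fun=> 1)) s :> R.
Proof.
move=> s1; have := @zeta_remove 1 2 s s1 isT isT.
by rewrite mul1n restrict_coprime1 => ->.
Qed.

Lemma Lchi_odd_part d s : 1 < s -> (1 - (chi d 2)%:~R * 2 `^ (- s)) * Lchi d s =
  dirichlet_series (restrict_coprime 2 (chiR d)) s :> R.
Proof.
move=> s1; have := @Lchi_remove 1 2 d s s1 isT isT.
by rewrite mul1n restrict_coprime1 => ->.
Qed.

Lemma sqr_lt_scaled_sqr (z L D a b D0 : R) : 0 <= z -> z <= a -> 0 <= b -> b <= L ->
  D0 <= D -> 0 <= D0 -> a ^+ 2 < D0 * b ^+ 2 -> z ^+ 2 < D * L ^+ 2.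
Proof.
move=> z0 za b0 bL DD D00 ab.
have za2 : z ^+ 2 <= a ^+ 2 by rewrite ler_sqr ?nnegrE //; lra.
have bL2 : b ^+ 2 <= L ^+ 2 by rewrite ler_sqr ?nnegrE //; lra.
apply: (le_lt_trans za2); apply: (lt_le_trans ab).
by apply: ler_pM => //; rewrite sqr_ge0.
Qed.

Lemma chi2_cases d : chi d 2 \in [:: -1; 0; 1 : int].
Proof. exact: kronecker_cases. Qed.

Lemma two_powN2 : 2 `^ (- 2) = 4^-1 :> R.
Proof. by rewrite powR_invn ?ler0n // -natrX. Qed.

Lemma two_powN3 : 2 `^ (- 3) = 8^-1 :> R.
Proof. by rewrite powR_invn ?ler0n // -natrX. Qed.

Lemma chi_odd_sum_ge2 d s : 1 < s ->
  2 <= dirichlet_series (restrict_coprime 2 (chiR d)) s +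
       dirichlet_series (restrict_coprime 2 (fun=> 1)) s :> R.
Proof.
by move=> s1; apply: dirichlet_restrict_sum_ge2 => //; [exact: chi_mult|exact: chi_bounded].
Qed.

Lemma zeta3_lt d : (1 < d)%N -> squarefree d ->
  zeta (3 : R) ^+ 2 < d%:R * Lchi d 3 ^+ 2.
Proof.
move=> d1 sq; have s1 : 1 < 3 :> R by lra.
have z0 := zeta_gt0 s1.
have := zeta_odd_part s1; have := Lchi_odd_part d s1; have := chi_odd_sum_ge2 d s1.
have := odd_zeta3_le R; rewrite two_powN3.
move: (dirichlet_series _ _) (dirichlet_series _ _) => Z L2 Zle L2ge LE zE.
have zle : zeta (3 : R) <= 26 / 21 by lra.
(* The odd part of L is at least [2 - 13/12 = 11/12]. If [d] is not 1 modulo 4 it is all of L;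
   otherwise [5 <= d], and the factor at 2 is at most 9/8, whence 22/27. *)
have [d4|d4] := eqVneq (d %% 4)%N 1%N; last first.
  apply: (@sqr_lt_scaled_sqr _ _ _ (26 / 21) (11 / 12) 2) => //; try lra.
  - by rewrite chi_prime2 // in LE; lra.
  - by rewrite ler_nat.
have d5 : (5 <= d)%N by move: d1 d4; case: d {sq LE} => [|[|[|[|[|d]]]]].
apply: (@sqr_lt_scaled_sqr _ _ _ (26 / 21) (22 / 27) 5) => //; try lra.
- have L0 := Lchi_gt0 d s1; move: LE.
  by have := chi2_cases d; rewrite !inE => /or3P[]/eqP-> LE; lra.
- by rewrite ler_nat.
Qed.

Lemma zeta2_lt d : (5 < d)%N -> squarefree d ->
  zeta (2 : R) ^+ 2 < d%:R * Lchi d 2 ^+ 2.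
Proof.
move=> d1 sq; have s1 : 1 < 2 :> R by lra.
have z0 := zeta_gt0 s1.
have := zeta_odd_part s1; have := Lchi_odd_part d s1; have := chi_odd_sum_ge2 d s1.
have := odd_zeta2_le R; rewrite two_powN2.
move: (dirichlet_series _ _) (dirichlet_series _ _) => Z L2 Zle L2ge LE zE.
have zle : zeta (2 : R) <= 5 / 3 by lra.
(* Here the odd part of L is at least 3/4, and in the second case the factor at 2 is at most 5/4,
   whence 3/5. *)
have [d4|d4] := eqVneq (d %% 4)%N 1%N; last first.
  apply: (@sqr_lt_scaled_sqr _ _ _ (5 / 3) (3 / 4) 6) => //; try lra.
  - by rewrite chi_prime2 // in LE; lra.
  - by rewrite ler_nat.
have d13 : (13 <= d)%N.
  have d9 : d != 9%N.
    by apply: contraPneq sq => -> /(_ 3%N isT).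
  lia.
apply: (@sqr_lt_scaled_sqr _ _ _ (5 / 3) (3 / 5) 13) => //; try lra.
- have L0 := Lchi_gt0 d s1; move: LE.
  by have := chi2_cases d; rewrite !inE => /or3P[]/eqP-> LE; lra.
- by rewrite ler_nat.
Qed.

Lemma zeta2_gt_d2 : 2 * Lchi 2 2 ^+ 2 < zeta 2 ^+ 2 :> R.
Proof.
have s1 : 1 < 2 :> R by lra.
have := @dirichlet_restrict_le R (chiR 2) 2 (1 * 2 * 3) (chi_bounded 2) s1.
rewrite !zeta_remove // !Lchi_remove // !restrict_coprime1 -/(zeta 2) -LchiE.
rewrite chi_prime2 // (@chi_odd_prime 2 3) //=.
rewrite !powR_invn ?ler0n //.
have := zeta_gt0 s1; have := Lchi_gt0 2 s1.
move: (zeta _) (Lchi _ _) => z L L0 z0 le.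
(* Removing 2 and 3, where the character is 0 and -1, gives [(10/9) L <= (3/4)(8/9) z]. *)
have Lz : L <= 3 / 5 * z by move: le; lra.
have : L ^+ 2 <= (3 / 5 * z) ^+ 2 by rewrite ler_sqr ?nnegrE //; lra.
have : 0 < z ^+ 2 by rewrite exprn_gt0.
rewrite exprMn; lra.
Qed.

Lemma zeta2_gt_d5 : 5 * Lchi 5 2 ^+ 2 < zeta 2 ^+ 2 :> R.
Proof.
have s1 : 1 < 2 :> R by lra.
have := @dirichlet_restrict_le R (chiR 5) 2 (1 * 2 * 3 * 5 * 7) (chi_bounded 5) s1.
rewrite !zeta_remove // !Lchi_remove // !restrict_coprime1 -/(zeta 2) -LchiE.
rewrite chi5_prime2 (@chi_odd_prime 5 3) // (@chi_odd_prime 5 5) //.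
rewrite (@chi_odd_prime 5 7) //=.
rewrite !powR_invn ?ler0n //.
have := zeta_gt0 s1; have := Lchi_gt0 5 s1.
move: (zeta _) (Lchi _ _) => z L L0 z0 le.
(* Removing the primes up to 7 bounds [L / z] by about 0.4424, and 4/9 is still below the reciprocal
   of the square root of 5. *)
have Lz : L <= 4 / 9 * z by move: le; lra.
have : L ^+ 2 <= (4 / 9 * z) ^+ 2 by rewrite ler_sqr ?nnegrE //; lra.
have : 0 < z ^+ 2 by rewrite exprn_gt0.
rewrite exprMn; lra.
Qed.

Lemma zeta2_d3 : zeta 2 ^+ 2 = 3 * Lchi 3 2 ^+ 2 :> R.
Proof.
have s1 : 1 < 2 :> R by lra.
have LE : Lchi 3 2 = 144^-1 * (1 * (pi ^+ 2 / sin (pi * (1 / 12)) ^+ 2) +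
            (-1) * (pi ^+ 2 / sin (pi * (5 / 12)) ^+ 2)) :> R.
  apply: dirichlet_mod12; first exact: chi_bounded.
  move=> n n0; rewrite chi3_mod12 //; have : (n %% 12 < 12)%N by rewrite ltn_mod.
  move: (n %% 12)%N; do 12 (case; [by []|]); lia.
have zE : (1 - 3 `^ (- 2)) * ((1 - 2 `^ (- 2)) * zeta 2) =
   144^-1 * (1 * (pi ^+ 2 / sin (pi * (1 / 12)) ^+ 2) +
             1 * (pi ^+ 2 / sin (pi * (5 / 12)) ^+ 2)) :> R.
  rewrite zeta_odd_part // -zeta_remove //.
  apply: dirichlet_mod12; first exact/restrict_coprime_bounded/one_bounded.
  move=> n n0; rewrite /restrict_coprime.
  have -> : coprime (2 * 3) n = coprime (2 * 3) (n %% 12).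
    by rewrite /coprime -[in RHS]gcdn_modr modn_dvdm // gcdn_modr.
  have : (n %% 12 < 12)%N by rewrite ltn_mod.
  move: (n %% 12)%N; do 12 (case; [by []|]); lia.
move: zE; rewrite LE !powR_invn ?ler0n //.
have -> : pi * (5 / 12) = pi / 2 - pi * (1 / 12) :> R by lra.
set y := pi * (1 / 12).
have -> : sin (pi / 2 - y) = cos y.
  by rewrite sinB sin_pihalf cos_pihalf mul0r subr0 mul1r.
have yp : 0 < y by rewrite mulr_gt0 ?pi_gt0 //; lra.
have y2 : y < pi / 2 by have := @pi_gt0 R; rewrite /y; lra.
have s0 : 0 < sin y by rewrite sin_gt0_pihalf ?yp.
have c0 : 0 < cos y by apply: cos_gt0_pihalf; apply/andP; split; lra.
have cs := cos2Dsin2 y.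
(* The bracket is [cos x] for [x = 2y = pi / 6], and [cos (3x) = 0] with [cos x > 0] gives
   [4 cos^2 x = 3]. *)
have cos2y : 4 * (cos y ^+ 2 - sin y ^+ 2) ^+ 2 = 3.
  have [x xE] : exists x, x = y + y by eexists.
  have CE : cos y ^+ 2 - sin y ^+ 2 = cos x by rewrite xE -[y + y]/(y *+ 2) cos_mulr2n mulr2n; lra.
  have C0 : 0 < cos x.
    apply: cos_gt0_pihalf; rewrite xE /y.
    by have := @pi_gt0 R; move=> ?; apply/andP; split; lra.
  have : cos (x *+ 2 + x) = 0.
    by rewrite -[RHS]cos_pihalf; congr cos; rewrite -[x *+ 2]/(x + x) xE /y; lra.
  have := cos2Dsin2 x; rewrite cosD cos_mulr2n sin_mulr2n CE !mulr2n.
  move: (cos x) (sin x) C0 => C S C0 CS triple.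
  have {triple} : C * (4 * C ^+ 2 - 3) = 0.
    have S2 : S ^+ 2 = 1 - C ^+ 2 by lra.
    have -> : C * (4 * C ^+ 2 - 3) = (C ^+ 2 + C ^+ 2 - 1) * C -
      (C * S + C * S) * S + 2 * C * (S ^+ 2 - (1 - C ^+ 2)) by ring.
    by rewrite triple S2 subrr mulr0 addr0.
  move/eqP; rewrite mulf_eq0 (gt_eqF C0) /= => /eqP; lra.
(* Over this common factor zeta(2) is [Q / 96] and L is [Q cos(2y) / 144]. *)
pose Q : R := pi ^+ 2 / (sin y ^+ 2 * cos y ^+ 2).
have sn : sin y != 0 by rewrite lt0r_neq0.
have cn : cos y != 0 by rewrite lt0r_neq0.
have -> : 1 * (pi ^+ 2 / sin y ^+ 2) + 1 * (pi ^+ 2 / cos y ^+ 2) =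
          Q * (cos y ^+ 2 + sin y ^+ 2).
  by rewrite /Q; field; rewrite sn cn.
have -> : 1 * (pi ^+ 2 / sin y ^+ 2) + -1 * (pi ^+ 2 / cos y ^+ 2) =
          Q * (cos y ^+ 2 - sin y ^+ 2).
  by rewrite /Q; field; rewrite sn cn.
rewrite cs mulr1; move: Q => Q zE.
have -> : zeta 2 = Q / 96 :> R by move: zE; lra.
move: (cos y ^+ 2 - sin y ^+ 2) cos2y => C cos2y.
have C2 : C ^+ 2 = 3 / 4 by lra.
by rewrite !exprMn C2; field.
Qed.

Lemma null_crossing_exists d : (1 < d)%N -> squarefree d ->
  exists s, null_crossing_eq d s.
Proof.
move=> d1 sq; have M0 : (0 < 8 * d)%N by lia.
have bnd s : 1 < s -> dirichlet_series (restrict_coprime (8 * d) (chiR d)) s <= (8 * d)%:R.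
  have E : restrict_coprime (8 * d) (chiR d) = fun n => (restrict_coprime (8 * d) (chi d) n)%:~R.
    by apply/funext => n; rewrite /restrict_coprime; case: ifP.
  apply: dirichlet_periodic_bound => //.
  - by move=> n; rewrite E chi_periodic.
  - rewrite E -[RHS](_ : (0 : int)%:~R = 0 :> R) // -(chi_sum_period d1 sq).
    by rewrite rmorph_sum.
  - by rewrite /restrict_coprime /coprime gcdn0; case: eqP => //; lia.
  - move=> n; rewrite /restrict_coprime; case: ifPn => [cn|_]; last by rewrite normr0.
    apply: chi_bounded; rewrite lt0n; apply: contraL cn => /eqP ->.
    by rewrite /coprime gcdn0; lia.
(* The difference of the two sides is positive at [s0 < 2] and negative at 3, so the intermediate
   value theorem applies. *)
have [s0 /andP[s1 s2] Hs] := zeta_dominates (chi_mult d) (chi_bounded d) M0 (ler0n R d) bnd.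
pose h s := zeta s ^+ 2 - d%:R * Lchi d s ^+ 2.
have hc : {within `[s0, 3], continuous h}.
  apply: continuous_in_subspaceT => s; rewrite inE /= in_itv /= => /andP[ss _].
  have s1' : 1 < s by lra.
  have cz := continuous_dirichlet (@one_bounded R) s1'.
  have cl := continuous_dirichlet (chi_bounded d) s1'.
  rewrite /continuous_at /h; apply: cvgB; first by apply: cvgM.
  by apply: cvgMl_tmp; apply: cvgM.
have hs0 : 0 < h s0 by rewrite /h subr_gt0.
have h3 : h 3 < 0 by rewrite /h subr_lt0 zeta3_lt.
have s03 : s0 <= 3 by lra.
have [|c] := IVT s03 hc (v := 0).
  by rewrite ge_min le_max (ltW hs0) (ltW h3) orbT.
rewrite in_itv /= => /andP[cs _] /eqP; rewrite /h subr_eq0 => /eqP E.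
by exists c; split => //; lra.
Qed.

(** Existence and uniqueness together exclude the default value 0 of [xget]. *)
Lemma null_crossingP d : (1 < d)%N -> squarefree d ->
  null_crossing_eq d (null_crossing R d).
Proof.
move=> d1 sq; have [s Hs] := null_crossing_exists d1 sq.
suff [] : unique (null_crossing_eq d) (null_crossing R d) by [].
apply: (@xgetPex _ 0 [set s | unique (null_crossing_eq d) s]).
by exists s; split => // t Ht; apply: null_crossing_eq_inj d1 Hs Ht.
Qed.

Lemma null_crossing_lt3 d s : (1 < d)%N -> squarefree d -> null_crossing_eq d s -> s < 3.
Proof.
move=> d1 sq [s1 Es]; rewrite ltNge; apply/negP => s3.
have s31 : 1 < 3 :> R by lra.
move: s3; rewrite le_eqVlt => /orP[/eqP s3|s3].
  by have := zeta3_lt d1 sq; rewrite s3 Es ltxx.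
have := ratio_decreasing d1 s31 s3; apply/negP; rewrite -leNgt.
rewrite -(@ler_pXn2r _ 2) ?nnegrE ?(ltW (ratio_gt0 _ _)) //.
move/(null_crossing_eq_ratio d s1): Es => ->.
by rewrite expr_div_n ler_pdivrMr ?exprn_gt0 ?Lchi_gt0 // ltW // zeta3_lt.
Qed.

End NullCrossing.

Theorem mainTheorem19 (R : realType) :
  (forall d : nat, (1 < d)%N -> squarefree d ->
     (null_crossing R d \is a Num.int <-> d = 3%N)) /\
  null_crossing R 3 = 2.
Proof.
have sq3 : squarefree 3.
  by move=> [|[|m]] // /dvdn_leq; rewrite expnS expn1; nia.
have nc3 : null_crossing R 3 = 2.
  apply: (@null_crossing_eq_inj R 3) => //; first exact: null_crossingP.
  by split; [lra|exact: zeta2_d3].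
split => // d d1 sq; split => [|->]; last by rewrite nc3.
have Hs := null_crossingP R d1 sq; have s3 := null_crossing_lt3 d1 sq Hs.
move=> /intrP[k kE]; rewrite kE in Hs s3.
have k2 : k = 2.
  have [k1 _] := Hs; move: k1 s3; rewrite (ltr_int R 1) (ltr_int R k 3); lia.
have [_ E] := Hs; rewrite k2 in E.
(* Among 2, 3, 4, 5, the value 4 is not squarefree, and at 2 and 5 the crossing equation fails at
   [s = 2] by a strict inequality. *)
have [d5|d5] := ltnP 5 d; first by have := zeta2_lt R d5 sq; rewrite E ltxx.
have : d != 4%N by apply: contraPneq sq => -> /(_ 2%N isT).
have : d != 2%N.
  by apply: contraPneq E => -> E; have := zeta2_gt_d2 R; rewrite E ltxx.
have : d != 5%N.
  by apply: contraPneq E => -> E; have := zeta2_gt_d5 R; rewrite E ltxx.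
lia.
Qed.
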